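(* Let $p$ be a prime, let $k\geq 1$, and let $a_1,a_2,\ldots,a_k\geq 2$ be integers. Further let $n$ be a non-negative integer with $n\leq 1+2\sum_{i=1}^k(a_i-1)$. Then there exists a spherical latin bitrade whose canonical group is isomorphic to $$\mathbb{Z}_p^n\oplus\left(\bigoplus_{i=1}^k\mathbb{Z}_{pa_i}\right).$$
   Context: Partial latin square: given finite, pairwise disjoint sets $R$ (rows), $C$ (columns), $S$ (symbols), a partial latin square is a subset $P\subseteq R\times C\times S$ such that any two distinct triples of $P$ agree in at most one coordinate; it is assumed that every element of $R$, $C$ and $S$ occurs in some triple of $P$. Latin bitrade: an ordered pair $(W,B)$ of non-empty partial latin squares (with common sets $R,C,S$) such that for each triple $(r,c,s)\in W$ (respectively $B$) there exist unique $r'\neq r$, $c'\neq c$, $s'\neq s$ with $\{(r',c,s),(r,c',s),(r,c,s')\}\subset B$ (respectively $W$). Its size is $|W|=|B|$. It is connected if there is no latin bitrade $(W',B')$ with $W'\subsetneq W$ and $B'\subsetneq B$. Separated: for each row $r$, define a permutation $\rho_r$ of the symbols in row $r$ by $\rho_r(s)=s'$ if and only if $(r,c,s)\in W$ and $(r,c,s')\in B$ for some $c\in C$; the row $r$ is separated if $\rho_r$ is a single cycle. Separated columns and symbols are defined analogously. The bitrade is separated if every row, column and symbol is separated. Spherical: from a connected separated latin bitrade $(W,B)$ construct a face two-coloured triangulation of a closed orientable surface with vertex set $R\sqcup C\sqcup S$, with an edge between two vertices if and only if they occur together in a triple of $W$ (equivalently of $B$), a white triangular face with vertices $r,c,s$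 for each $(r,c,s)\in W$, and a black triangular face with vertices $r,c,s$ for each $(r,c,s)\in B$. A spherical latin bitrade is a connected separated latin bitrade for which this surface is the sphere (equivalently, a connected latin bitrade with $|R|+|C|+|S|=|W|+2$). Canonical group: for a partial latin square $P$ with sets $R,C,S$, let $\mathcal{A}_P$ be the abelian group with generating set $R\cup C\cup S$ subject to the relations $r+c+s=0$ for all $(r,c,s)\in P$. It is known that for a spherical latin bitrade $(W,B)$ one has $\mathcal{A}_W\cong\mathcal{A}_B\cong\mathbb{Z}\oplus\mathbb{Z}\oplus\mathcal{C}$ with $\mathcal{C}$ finite. The group $\mathcal{C}$ (the torsion subgroup of $\mathcal{A}_W$) is called the canonical group of $(W,B)$. $\mathbb{Z}_n$ denotes the cyclic group of order $n$. *)

(* Defs.v *)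
From HB Require Import structures.
From mathcomp Require Import all_boot all_order all_algebra all_fingroup.
From mathcomp Require Import boolp.

Set Implicit Arguments.
Unset Strict Implicit.
Unset Printing Implicit Defensive.

Import GRing.Theory.
Local Open Scope ring_scope.

Section Bitrades.

(* Disjointness of rows, columns and symbols is ensured by typing: the vertex
   set is the disjoint sum [R + C + S]. *)
Variables R C S : finType.

Local Notation triple := (R * C * S)%type.
Local Notation vertex := (R + C + S)%type.

Implicit Types (rows : {set R}) (cols : {set C}) (syms : {set S}).
Implicit Types (P Q W B : {set triple}).

Definition agreements (t u : triple) : nat :=
  ((t.1.1 == u.1.1) + (t.1.2 == u.1.2) + (t.2 == u.2))%N.

(* The carriers [rows], [cols], [syms] are explicit subsets because the
   sub-bitrades in the definition of connectedness may use fewer rows, columns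
   and symbols than the ambient bitrade. *)
Definition partial_latin_square rows cols syms P : Prop :=
  [/\ forall r c s, (r, c, s) \in P -> [/\ r \in rows, c \in cols & s \in syms],
      forall t u, t \in P -> u \in P -> t != u -> (agreements t u <= 1)%N
    & [/\ forall r, r \in rows -> exists c s, (r, c, s) \in P,
          forall c, c \in cols -> exists r s, (r, c, s) \in P
        & forall s, s \in syms -> exists r c, (r, c, s) \in P]].

Definition mates P Q : Prop :=
  forall r c s, (r, c, s) \in P ->
    [/\ exists! r', r' != r /\ (r', c, s) \in Q,
        exists! c', c' != c /\ (r, c', s) \in Q
      & exists! s', s' != s /\ (r, c, s') \in Q].

Definition latin_bitrade rows cols syms W B : Prop :=
  [/\ partial_latin_square rows cols syms W,
      partial_latin_square rows cols syms B,
      W != set0 /\ B != set0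
    & mates W B /\ mates B W].

Definition connected_bitrade W B : Prop :=
  ~ exists rows cols syms W' B',
      [/\ latin_bitrade rows cols syms W' B', W' \proper W & B' \proper B].

Definition single_cycle_on (T : finType) (A : {set T}) (e : T -> T -> Prop) :=
  exists sigma : {perm T},
    [/\ perm_on A sigma,
        forall x y, x \in A -> y \in A -> (sigma x = y <-> e x y)
      & A \in porbits sigma].

Definition row_symbols W (r : R) : {set S} :=
  [set s | [exists c, (r, c, s) \in W]].
Definition column_rows W (c : C) : {set R} :=
  [set r | [exists s, (r, c, s) \in W]].
Definition symbol_columns W (s : S) : {set C} :=
  [set c | [exists r, (r, c, s) \in W]].

(* In a given row the induced permutations of the symbols and of the columns are
   conjugate, and likewise for columns and symbols; which coordinate is permuted
   is therefore immaterial for being a single cycle. *)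
Definition separated_row W B (r : R) : Prop :=
  single_cycle_on (row_symbols W r)
    (fun s s' => exists c, (r, c, s) \in W /\ (r, c, s') \in B).
Definition separated_column W B (c : C) : Prop :=
  single_cycle_on (column_rows W c)
    (fun r r' => exists s, (r, c, s) \in W /\ (r', c, s) \in B).
Definition separated_symbol W B (s : S) : Prop :=
  single_cycle_on (symbol_columns W s)
    (fun c c' => exists r, (r, c, s) \in W /\ (r, c', s) \in B).

Definition separated_bitrade W B : Prop :=
  [/\ forall r, separated_row W B r,
      forall c, separated_column W B c
    & forall s, separated_symbol W B s].

Definition corners (t : triple) : {set vertex} :=
  [set inl (inl t.1.1); inl (inr t.1.2); inr t.2].

Definition edges W : {set {set vertex}} :=
  [set e : {set vertex} | (#|e| == 2)%N && [exists t in W, e \subset corners t]].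

Definition white_faces W : {set {set vertex}} := [set corners t | t in W].
Definition black_faces B : {set {set vertex}} := [set corners t | t in B].

Definition euler_characteristic W B : int :=
  #|[set: vertex]|%:Z - #|edges W|%:Z
    + (#|white_faces W|%:Z + #|black_faces B|%:Z).

(* For a connected separated bitrade the triangulated surface is connected,
   closed and orientable, so it is the sphere exactly when its Euler
   characteristic is 2. *)
Definition spherical_bitrade W B : Prop :=
  [/\ latin_bitrade [set: R] [set: C] [set: S] W B,
      connected_bitrade W B,
      separated_bitrade W B
    & euler_characteristic W B = 2].

End Bitrades.

Section Torsion.

Variable A : zmodType.

Definition torsion (x : A) : bool :=
  `[< exists2 m : nat, (0 < m)%N & x *+ m = 0 >].

Fact torsion_zmod_closed : zmod_closed torsion.
Proof.
split; first by apply/asboolP; exists 1%N.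
move=> x y /asboolP[m m0 xm] /asboolP[n n0 yn].
apply/asboolP; exists (m * n)%N; first by rewrite muln_gt0 m0.
by rewrite mulrnBl mulrnA xm mul0rn mulnC mulrnA yn mul0rn subrr.
Qed.

HB.instance Definition _ := GRing.isZmodClosed.Build A torsion
  torsion_zmod_closed.

Definition torsion_subgroup : Type := {x : A | torsion x}.

HB.instance Definition _ := SubChoice.on torsion_subgroup.
HB.instance Definition _ :=
  [SubChoice_isSubZmodule of torsion_subgroup by <:].

End Torsion.

Section DirectSum.

Variables (I : finType) (A : I -> zmodType).

Definition direct_sum : Type := {dffun forall i : I, A i}.

HB.instance Definition _ := Choice.on direct_sum.

Implicit Types f g h : direct_sum.

Definition dsum_zero : direct_sum := [ffun i => 0 : A i].
Definition dsum_opp f : direct_sum := [ffun i => - f i : A i].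
Definition dsum_add f g : direct_sum := [ffun i => f i + g i : A i].

Fact dsum_addA : associative dsum_add.
Proof. by move=> f g h; apply/ffunP=> i; rewrite !ffunE addrA. Qed.
Fact dsum_addC : commutative dsum_add.
Proof. by move=> f g; apply/ffunP=> i; rewrite !ffunE addrC. Qed.
Fact dsum_add0 : left_id dsum_zero dsum_add.
Proof. by move=> f; apply/ffunP=> i; rewrite !ffunE add0r. Qed.
Fact dsum_addN : left_inverse dsum_zero dsum_opp dsum_add.
Proof. by move=> f; apply/ffunP=> i; rewrite !ffunE addNr. Qed.

HB.instance Definition _ := GRing.isZmodule.Build direct_sum
  dsum_addA dsum_addC dsum_add0 dsum_addN.

End DirectSum.

Definition zmod_isomorphic (A B : zmodType) : Prop :=
  exists f : {additive A -> B}, bijective f.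

Section CanonicalGroup.

Variables R C S : finType.

Local Notation triple := (R * C * S)%type.
Local Notation free_group := {ffun R + C + S -> int}.

Definition generator (v : R + C + S) : free_group := [ffun u => (u == v)%:R].

Definition relator (t : triple) : free_group :=
  generator (inl (inl t.1.1)) + generator (inl (inr t.1.2))
    + generator (inr t.2).

Variable P : {set triple}.

Definition relations (x : free_group) : bool :=
  `[< exists c : triple -> int, x = \sum_(t in P) relator t *~ c t >].

Fact relations_zmod_closed : zmod_closed relations.
Proof.
split.
  by apply/asboolP; exists (fun=> 0); rewrite big1 // => t _; rewrite mulr0z.
move=> x y /asboolP[c ->] /asboolP[d ->].
apply/asboolP; exists (fun t => c t - d t).
by rewrite -sumrB; apply: eq_bigr => t _; rewrite mulrzBr.
Qed.

HB.instance Definition _ := GRing.isZmodClosed.Build free_group relations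
  relations_zmod_closed.

Definition presented_group : zmodType :=
  Quotient.quot (GRing.ZmodClosed.clone _ relations _).

End CanonicalGroup.

(* For a spherical bitrade [(W, B)] the groups presented by [W] and by [B] are
   isomorphic, so [B] is not needed. *)
Definition canonical_group (R C S : finType) (W : {set R * C * S}) : zmodType :=
  torsion_subgroup (presented_group W).

(* Main.v *)
(** A bitrade on the sphere is a plane digraph whose arcs alternate in direction
    around every vertex.  Symbols are the vertices, rows and columns are the
    faces to the left and to the right of the arcs, and an arc from x to y
    between the faces l and r gives the white triple (l, r, x) and the black
    triple (l, r, y).  We start from a loop, subdivide arcs, and replace arcs by
    bundles of m forward and m - 1 backward parallel arcs; eliminating the new
    faces, such a bundle imposes the single relation
    l + r + x = (m - 1) (y - x).

    Subdividing an arc by w and bundling its first half p-fold replaces the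
    relation l + r + x = 0 by l + r + x = eta with p eta = 0.  If moreover one
    arc from x to w of that bundle is subdivided again and its second half is
    replaced by a bundle of a forward and a - 1 backward arcs carrying twists
    eta_i of order p, then eta = a zeta - (sum of +- eta_i) with p a zeta = 0:
    a new summand Z_(p a) appears beside one Z_p for each eta_i.  Of the 2a - 1
    arcs of the inner bundle, one carries the construction for the next a_i and
    the 2a - 2 others are free to be twisted; for the last a_i all 2a - 1 are
    free, whence the bound on n. *)

Require Import Defs.
From HB Require Import structures.
From mathcomp Require Import all_boot all_order all_algebra all_fingroup.
From mathcomp Require Import boolp zify ring.

Set Implicit Arguments.
Unset Strict Implicit.
Unset Printing Implicit Defensive.

Import GRing.Theory.

(** * Plane digraphs *)

(** The equivalence relation generated by [step], in impredicative form: every [step]-invariant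
    property of [a] holds of [b]. Invariant sets of arcs or labels can then be fed in directly. *)
Variant linked (A : Type) (step : A -> A -> Prop) (a b : A) : Prop :=
  Linked of forall X : A -> Prop,
    (forall u v, step u v -> (X u <-> X v)) -> X a -> X b.

Section Linked.

Variables (A : Type) (s : A -> A -> Prop).

Lemma linked_refl a : linked s a a. Proof. by split. Qed.

Lemma linked_step a b : s a b -> linked s a b.
Proof. by move=> sab; split=> X Xs /(Xs _ _ sab). Qed.

Lemma linked_trans a b c : linked s a b -> linked s b c -> linked s a c.
Proof. by case=> ab [bc]; split=> X Xs /(ab X Xs) /(bc X Xs). Qed.

Lemma linked_sym a b : linked s a b -> linked s b a.
Proof.
case=> ab; split=> X Xs.
by apply: (ab (fun u => X u -> X a)) => // u v /Xs uv; split=> h /uv /h.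
Qed.

End Linked.

Lemma linked_map A B (s : A -> A -> Prop) (s' : B -> B -> Prop) (f : A -> B) :
  (forall a b, s a b -> linked s' (f a) (f b)) ->
  forall a b, linked s a b -> linked s' (f a) (f b).
Proof.
move=> sf a b [ab]; apply: (ab (fun u => linked s' (f a) (f u))); last first.
  exact: linked_refl.
move=> u v /sf fuv; split=> h; apply: linked_trans h _ => //.
exact: linked_sym.
Qed.

Record net := Net {
  arc : finType; rows : finType; cols : finType; syms : finType;
  left_of : arc -> rows; right_of : arc -> cols;
  tail : arc -> syms; head : arc -> syms }.

Arguments left_of {n}.
Arguments right_of {n}.
Arguments tail {n}.
Arguments head {n}.

Section Steps.

Variable D : net.
Implicit Types a b d : arc D.

(** Arcs alternate in direction at every vertex, so every face boundary is a directed cycle; a step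
    moves one arc forward on it. *)
Definition left_step a b := left_of a = left_of b /\ head a = tail b.
Definition right_step a b := right_of a = right_of b /\ head a = tail b.
(* Consecutive outgoing arcs at a vertex are separated by one incoming arc. *)
Definition turn a b := exists2 d, left_step d a & right_step d b.
Definition step a b := left_step a b \/ right_step a b.

Record planar : Prop := Planar {
  left_tail_inj : forall a b, left_of a = left_of b -> tail a = tail b -> a = b;
  right_tail_inj :
    forall a b, right_of a = right_of b -> tail a = tail b -> a = b;
  left_pred : forall b, exists a, left_step a b;
  right_pred : forall b, exists a, right_step a b;
  row_used : forall x, exists a, left_of a = x;
  col_used : forall x, exists a, right_of a = x;
  sym_used : forall x, exists a, tail a = x;
  row_linked : forall a b, left_of a = left_of b -> linked left_step a b;
  col_linked : forall a b, right_of a = right_of b -> linked right_step a b;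
  sym_linked : forall a b, tail a = tail b -> linked turn a b;
  net_linked : forall a b, linked step a b;
  euler : #|rows D| + #|cols D| + #|syms D| = #|arc D| + 2 }.

(** A choice of predecessors is injective because [s] is functional, hence it is a permutation of
    the finite set of arcs. *)
Lemma onto_of_pred (s : arc D -> arc D -> Prop) :
    (forall a b c, s a b -> s a c -> b = c) -> (forall b, exists a, s a b) ->
  forall a, exists b, s a b.
Proof.
move=> s_fun /choice[f fP]; have f_inj : injective f.
  by move=> a b ab; apply: s_fun (fP a) _; rewrite ab.
by have [g _ gK] := injF_bij f_inj => a; exists (g a); rewrite -{1}(gK a).
Qed.

Hypothesis D0 : planar.

Lemma left_succ a : exists b, left_step a b.
Proof.
apply: onto_of_pred a => [a b c [lb hb] [lc hc]|]; last exact: left_pred D0.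
by apply: (left_tail_inj D0); rewrite -?lb -?hb.
Qed.

Lemma right_succ a : exists b, right_step a b.
Proof.
apply: onto_of_pred a => [a b c [lb hb] [lc hc]|]; last exact: right_pred D0.
by apply: (right_tail_inj D0); rewrite -?lb -?hb.
Qed.

(** Passing to the predecessor permutes the arcs, so every arc is a predecessor and its head is the
    tail of its successor; [left_tail_inj] applied to successors gives the claim. *)
Lemma left_head_inj a b : left_of a = left_of b -> head a = head b -> a = b.
Proof.
have /choice[f fP] := left_pred D0; have f_inj : injective f.
  move=> c d cd; have [[lc hc] [ld hd]] := (fP c, fP d).
  by apply: (left_tail_inj D0); rewrite -?lc -?hc cd.
have [g _ gK] := injF_bij f_inj; rewrite -{1 2}(gK a) -{1 2}(gK b).
have [[-> ->] [-> ->]] := (fP (g a), fP (g b)) => l t.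
by rewrite -[a]gK -[b]gK (left_tail_inj D0 l t).
Qed.

Lemma right_head_inj a b : right_of a = right_of b -> head a = head b -> a = b.
Proof.
have /choice[f fP] := right_pred D0; have f_inj : injective f.
  move=> c d cd; have [[lc hc] [ld hd]] := (fP c, fP d).
  by apply: (right_tail_inj D0); rewrite -?lc -?hc cd.
have [g _ gK] := injF_bij f_inj; rewrite -{1 2}(gK a) -{1 2}(gK b).
have [[-> ->] [-> ->]] := (fP (g a), fP (g b)) => l t.
by rewrite -[a]gK -[b]gK (right_tail_inj D0 l t).
Qed.

End Steps.

(** * Subdivision and tripling of arcs *)

Section Subdivide.

Variables (D : net) (e : arc D).

(* e becomes a path of two arcs: Some e, to the new vertex None, then None. *)
Definition subdivide : net :=
  @Net (option (arc D)) (rows D) (cols D) (option (syms D))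
    (fun a => left_of (odflt e a)) (fun a => right_of (odflt e a))
    (fun a => omap tail a)
    (fun a => if a is Some a then if a == e then None else Some (head a)
              else Some (head e)).

(** The piece that ends at the old head of [a], just as [Some a] is the piece that starts at its old
    tail. *)
Let inc (a : arc D) : arc subdivide := if a == e then None else Some a.

Lemma subdivide_left_step a b : left_step a b ->
  @left_step subdivide (inc a) (Some b).
Proof. by case=> l h; split=> /=; rewrite /inc; case: eqP => [<-|ne] //=;
  rewrite ?l ?h //; case: eqP => // _; rewrite h. Qed.

Lemma subdivide_right_step a b : right_step a b ->
  @right_step subdivide (inc a) (Some b).
Proof. by case=> l h; split=> /=; rewrite /inc; case: eqP => [<-|ne] //=;
  rewrite ?l ?h //; case: eqP => // _; rewrite h. Qed.

Lemma subdivide_left_inc a :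
  linked (@left_step subdivide) (Some a) (inc a).
Proof. rewrite /inc; case: eqP => [->|_];
  last exact: linked_refl. by apply: linked_step; split=> //=;
    rewrite eqxx. Qed.

Lemma subdivide_right_inc a :
  linked (@right_step subdivide) (Some a) (inc a).
Proof. rewrite /inc; case: eqP => [->|_];
  last exact: linked_refl. by apply: linked_step; split=> //=;
    rewrite eqxx. Qed.

(** A face step from [u] to [v] becomes the path [Some u], [inc u], [Some v], so each face keeps a
    single boundary cycle. One arc and one vertex are added, which leaves the Euler count
    balanced. *)
Lemma subdivide_planar : planar D -> planar subdivide.
Proof.
move=> D0; have incE : inc e = None by rewrite /inc eqxx.
have sL a b : left_of a = left_of b ->
    linked (@left_step subdivide) (Some a) (Some b).
  move/(row_linked D0); apply: (linked_map (f := fun a =>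
    Some a : arc subdivide)) => u v uv.
  apply: linked_trans (subdivide_left_inc u) _.
  exact: (linked_step (subdivide_left_step uv)).
have sR a b : right_of a = right_of b ->
    linked (@right_step subdivide) (Some a) (Some b).
  move/(col_linked D0); apply: (linked_map (f := fun a =>
    Some a : arc subdivide)) => u v uv.
  exact: linked_trans (subdivide_right_inc u) (linked_step
    (subdivide_right_step uv)).
have eL : linked (@left_step subdivide) (Some e) None.
  by rewrite -incE; apply: subdivide_left_inc.
have eR : linked (@right_step subdivide) (Some e) None.
  by rewrite -incE; apply: subdivide_right_inc.
split.
- by move=> [a|] [b|] //= l [] t; rewrite (left_tail_inj D0 l t).
- by move=> [a|] [b|] //= l [] t; rewrite (right_tail_inj D0 l t).
- move=> [b|]; last by exists (Some e); split=> //=; rewrite eqxx.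
  by have [a ab] := left_pred D0 b; exists (inc a); apply: subdivide_left_step.
- move=> [b|]; last by exists (Some e); split=> //=; rewrite eqxx.
  by have [a ab] := right_pred D0 b; exists (inc a);
    apply: subdivide_right_step.
- by move=> x; have [a <-] := row_used D0 x; exists (Some a).
- by move=> x; have [a <-] := col_used D0 x; exists (Some a).
- move=> [x|]; last by exists None.
  by have [a <-] := sym_used D0 x; exists (Some a).
- move=> [a|] [b|] //= l; first exact: sL.
  + exact: linked_trans (sL _ _ l) eL.
  + exact: linked_trans (linked_sym eL) (sL _ _ l).
- move=> [a|] [b|] //= l; first exact: sR.
  + exact: linked_trans (sR _ _ l) eR.
  + exact: linked_trans (linked_sym eR) (sR _ _ l).
- move=> [a|] [b|] //= [t]; apply: (linked_map (f := fun a =>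
    Some a : arc subdivide)) (sym_linked D0 t) => u v [d du dv].
  apply: linked_step; exists (inc d); first exact: subdivide_left_step.
  exact: subdivide_right_step.
- have sub st : (forall a b, st a b -> @step subdivide a b) ->
      forall a b, linked st a b -> linked (@step subdivide) a b.
    move=> h a b; apply: (linked_map (f := id)) => u v uv.
    exact/linked_step/h.
  have s a b : linked (@step subdivide) (Some a) (Some b).
    apply: (linked_map (f := fun a =>
      Some a : arc subdivide)) (net_linked D0 a b).
    move=> u v [[l _]|[l _]].
      by apply: sub (sL _ _ l) => c d; left.
    by apply: sub (sR _ _ l) => c d; right.
  have eS : linked (@step subdivide) (Some e) None.
    by apply: sub eL => c d; left.
  move=> [a|] [b|] //=.
    exact: linked_trans (s a e) eS.
  exact: linked_trans (linked_sym eS) (s e b).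
- by rewrite /= !card_option addnS (euler D0).
Qed.

End Subdivide.

Section Triple.

Variables (D : net) (e : arc D).

(* The arc e from x to y is replaced by three parallel arcs bounding two new
   digons: None from x to y, Some None from y to x, and Some (Some e) from x
   to y; None borders the old left face and Some (Some e) the old right one. *)
Definition triple : net :=
  @Net (option (option (arc D))) (option (rows D)) (option (cols D)) (syms D)
    (fun a => match a with
       | None => Some (left_of e)
       | Some None => None
       | Some (Some a) => if a == e then None else Some (left_of a) end)
    (fun a => if a is Some (Some a) then Some (right_of a) else None)
    (fun a => match a with
       | None => tail e | Some None => head e | Some (Some a) => tail a end)
    (fun a => match a with
       | None => head e | Some None => tail e | Some (Some a) => head a end).

(** This arc borders the old left face of [a], while [Some (Some a)] borders the old right face; the
    two differ only at [e]. *)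
Let lft (a : arc D) : arc triple := if a == e then None else Some (Some a).

Lemma lftE a : [/\ @left_of triple (lft a) = Some (left_of a),
  @tail triple (lft a) = tail a & @head triple (lft a) = head a].
Proof. by rewrite /lft; case: (eqVneq a e) => [->|ae] //=;
  rewrite (negPf ae). Qed.

Lemma triple_left_step a b : left_step a b -> @left_step triple (lft a) (lft b).
Proof.
by case=> l h; have [[la _ ha] [lb tb _]] := (lftE a, lftE b); split;
  rewrite ?la ?lb ?l ?ha ?tb.
Qed.

Lemma triple_right_step a b : right_step a b ->
  @right_step triple (Some (Some a)) (Some (Some b)).
Proof. by case=> l h; split=> /=; rewrite ?l ?h. Qed.

Lemma triple_turn_lft a :
  linked (@turn triple) (Some (Some a)) (lft a).
Proof.
rewrite /lft; case: eqP => [->|_]; last exact: linked_refl.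
by apply: linked_step; exists (Some None); split=> //=; rewrite eqxx.
Qed.

(** The boundary of a new digon starts one arc at each end of [e], so these ends must differ for
    tails to be distinct on it. Two arcs and two faces are added. *)
Lemma triple_planar : tail e <> head e -> planar D -> planar triple.
Proof.
move=> ne D0; have lft_e : lft e = None by rewrite /lft eqxx.
have lftN a : a != e -> lft a = Some (Some a) by rewrite /lft => /negPf ->.
have sL a b : left_of a = left_of b -> linked (@left_step triple) (lft a) (lft
  b).
  move/(row_linked D0); apply: (linked_map (f := lft)) => u v uv.
  exact/linked_step/triple_left_step.
have sR a b : right_of a = right_of b ->
    linked (@right_step triple) (Some (Some a)) (Some (Some b)).
  move/(col_linked D0); apply: (linked_map (f := fun a =>
    Some (Some a) : arc triple)) => u v uv.
  exact/linked_step/triple_right_step.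
have s32 : @left_step triple (Some (Some e)) (Some None).
  by split=> //=; rewrite eqxx.
have s23 : @left_step triple (Some None) (Some (Some e)).
  by split=> //=; rewrite eqxx.
have s12 : @right_step triple None (Some None) by [].
have s21 : @right_step triple (Some None) None by [].
have caseL (a : arc triple) :
    (exists2 b, a = lft b & left_of a = Some (left_of b)) \/
    (a = Some None \/ a = Some (Some e)).
  case: a => [[a|]|]; last 1 first.
  - by left; exists e.
  - case: (eqVneq a e) => [->|ae]; first by right; right.
    by left; exists a; rewrite ?lftN //= (negPf ae).
  - by right; left.
split.
- have absurd a : a != e -> left_of a = left_of e -> tail a <> tail e.
    by move=> ae l t; case/eqP: ae; apply: left_tail_inj l t.
  move=> [[a|]|] [[b|]|] //=; try case: (eqVneq a e) => [->|ae];
    try case: (eqVneq b e) => [->|be] //=; move=> l t;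
    first [ by [] | by case: ne
          | by case: l => l; rewrite (left_tail_inj D0 l t)
          | by case: l => l; case: (absurd a ae l t)
          | by case: l => l; case: (absurd b be (esym l) (esym t))].
- by move=> [[a|]|] [[b|]|] //= l t;
    first [ by [] | by case: ne
          | by case: l => l; rewrite (right_tail_inj D0 l t)].
- move=> b; have [[c -> _]|[]->] := caseL b;
    [|by exists (Some (Some e)) | by exists (Some None)].
  by have [a ab] := left_pred D0 c; exists (lft a); apply: triple_left_step.
- move=> [[b|]|]; [|by exists None | by exists (Some None)].
  by have [a ab] := right_pred D0 b; exists (Some (Some a));
    apply: triple_right_step.
- move=> [x|]; last by exists (Some None).
  have [a <-] := row_used D0 x; exists (lft a); rewrite /lft.
  by case: (eqVneq a e) => [->|ae] //=; rewrite (negPf ae).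
- move=> [x|]; last by exists None.
  by have [a <-] := col_used D0 x; exists (Some (Some a)).
- by move=> x; have [a <-] := sym_used D0 x; exists (Some (Some a)).
- move=> a b; have [[a' -> la]|a0] := caseL a; have [[b' -> lb]|b0] := caseL b.
  + by rewrite -?la -?lb => /[!la] /[!lb] -[] /sL.
  + by rewrite la; case: b0 => -> //=; rewrite eqxx.
  + by rewrite lb; case: a0 => -> //=; rewrite eqxx.
  + by case: a0 b0 => -> [] -> _ //; apply: linked_step.
- move=> [[a|]|] [[b|]|] //= l; first by case: l => l; exact: sR.
  + exact: linked_step.
  + exact: linked_step.
- have sT a b : tail a = tail b -> linked (@turn triple) (Some (Some a)) (Some
    (Some b)).
    move/(sym_linked D0); apply: (linked_map (f := fun a =>
      Some (Some a) : arc triple)) => u v [d du dv].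
    apply: linked_trans (triple_turn_lft u) _.
    (* A turn through the incoming arc [e] splits in two: the incoming [None] leads to the backward
       arc [Some None], and the incoming [Some (Some e)] leads from there to the image of [v]. *)
    case: (eqVneq d e) => [de|de].
      apply: (linked_trans (b := Some None)); apply: linked_step.
        exists None => //; have := triple_left_step du; by rewrite de lft_e.
      exists (Some (Some e)) => //; rewrite -de; exact: triple_right_step.
    apply: linked_step; exists (Some (Some d)); last exact: triple_right_step.
    by rewrite -lftN //; apply: triple_left_step.
  have e1 : linked (@turn triple) (Some (Some e)) None.
    by rewrite -lft_e; apply: triple_turn_lft.
  have [b be] := right_succ D0 e.
  have e2 : linked (@turn triple) (Some None) (Some (Some b)).
    by apply: linked_step; exists (Some (Some e)) => //;
      apply: triple_right_step.
  have base (a : arc triple) : exists2 c : arc D, tail a = tail c &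
      linked (@turn triple) a (Some (Some c)).
    case: a => [[a|]|]; first by exists a; last exact: linked_refl.
      by exists b; first by case: be.
    by exists e; last exact: linked_sym.
  move=> a c; have [a' ta aa'] := base a; have [c' tc cc'] := base c.
  rewrite ta tc => /sT a'c'; apply: linked_trans aa' _.
  exact: linked_trans a'c' (linked_sym cc').
- have lS a b : left_step a b -> @step triple a b by left.
  have rS a b : right_step a b -> @step triple a b by right.
  have lft_link a : linked (@step triple) (Some (Some a)) (lft a).
    rewrite /lft; case: eqP => [->|_]; last exact: linked_refl.
    exact: linked_trans (linked_step (lS _ _ s32)) (linked_step (rS _ _ s21)).
  have s a b : linked (@step triple) (Some (Some a)) (Some (Some b)).
    apply: (linked_map (f := fun a =>
      Some (Some a) : arc triple)) (net_linked D0 a b) => u v [uv|uv];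
        last first.
      exact/linked_step/rS/triple_right_step.
    apply: linked_trans (lft_link u) _.
    apply: linked_trans (linked_sym (lft_link v)).
    exact/linked_step/lS/triple_left_step.
  have base (a : arc triple) : linked (@step triple) (Some (Some e)) a.
    case: a => [[a|]|]; first exact: s.
      exact: linked_step (lS _ _ s32).
    exact: linked_trans (linked_step (lS _ _ s32)) (linked_step (rS _ _ s21)).
  by move=> a b; apply: linked_trans (linked_sym (base a)) (base b).
- by rewrite /= !card_option addSn addnS !addSn (euler D0).
Qed.

End Triple.

(** * Bitrades from plane digraphs *)

Section SingleCycle.

Variables (A T : finType) (P : {set A}) (u : A -> T) (next : A -> A).
Hypotheses (next_P : forall a, (next a \in P) = (a \in P))
  (next_inj : injective next) (u_inj : {in P &, injective u}).
Variable a0 : A.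
Hypothesis Pa0 : a0 \in P.
Hypothesis P_linked :
  forall a b, a \in P -> b \in P -> linked (fun c d => d = next c) a b.

Let f (x : T) : T :=
  if [pick a in P | u a == x] is Some a then u (next a) else x.

Let fE a : a \in P -> f (u a) = u (next a).
Proof.
move=> Pa; rewrite /f; case: pickP => [b /andP[Pb /eqP ub]|/(_ a)].
  by rewrite (u_inj Pb Pa ub).
by rewrite Pa eqxx.
Qed.

Let f_out x : x \notin u @: P -> f x = x.
Proof.
move=> xP; rewrite /f; case: pickP => // b /andP[Pb /eqP ub].
by case/negP: xP; rewrite -ub imset_f.
Qed.

Let f_inj : injective f.
Proof.
move=> x y; case: (boolP (x \in u @: P)) => [/imsetP[a Pa ->]|xP];
  case: (boolP (y \in u @: P)) => [/imsetP[b Pb ->]|yP].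
- by rewrite !fE // => nab; congr u; apply/next_inj/u_inj; rewrite ?next_P.
- by rewrite fE // (f_out yP) => yE; rewrite -yE imset_f // next_P in yP.
- by rewrite (f_out xP) fE // => xE; rewrite xE imset_f // next_P in xP.
- by rewrite !f_out.
Qed.

(** Serves rows, columns and symbols alike: [next] permutes the arcs of [P] in one cycle, and the
    labelling [u], injective on [P], carries this cycle to the labels; all other labels are
    fixed. *)
Lemma single_cycle_imset (e : T -> T -> Prop) :
    (forall a b, a \in P -> b \in P -> (e (u a) (u b) <-> u b = u (next a))) ->
  single_cycle_on (u @: P) e.
Proof.
move=> eP; exists (perm f_inj); have onP : perm_on (u @: P) (perm f_inj).
  apply/subsetP => x; rewrite inE permE; apply: contraR => xP.
  by rewrite f_out.
split=> //.
- move=> _ _ /imsetP[a Pa ->] /imsetP[b Pb ->]; rewrite permE fE // eP //.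
  by split=> ->.
- apply/imsetP; exists (u a0) => //; apply/eqP; rewrite eqEsubset; apply/andP;
    split.
    apply/subsetP => _ /imsetP[b Pb ->].
    have [/(_ (fun c => c \in P -> u c \in porbit (perm f_inj) (u a0)))] :=
      P_linked Pa0 Pb.
    apply=> // [c _ ->|_]; last exact: porbit_id.
    rewrite next_P; split=> orb Pc; have := orb Pc;
      by rewrite -!eq_porbit_mem -(fE Pc) -(permE f_inj) -[perm _ _]/((perm
        f_inj ^+ 1)%g _) porbit_perm.
  apply/subsetP => x /porbitP[i ->]; elim: i => [|i IH].
    by rewrite perm1 imset_f.
  by rewrite expgSr permM perm_closed.
Qed.

End SingleCycle.

Definition white (D : net) : {set rows D * cols D * syms D} :=
  [set (left_of a, right_of a, tail a) | a : arc D].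
Definition black (D : net) : {set rows D * cols D * syms D} :=
  [set (left_of a, right_of a, head a) | a : arc D].

Section Spherical.

Variable D : net.
Hypotheses (D0 : planar D)
  (simple : forall a b : arc D,
    left_of a = left_of b -> right_of a = right_of b -> a = b)
  (loopless : forall a : arc D, tail a <> head a).

Local Notation triples u := [set (left_of a, right_of a, u a) | a : arc D].

Let triplesP (u : arc D -> syms D) r c s :
  reflect (exists a, [/\ left_of a = r, right_of a = c & u a = s])
    ((r, c, s) \in triples u).
Proof.
apply: (iffP imsetP) => [[a _ [-> -> ->]]|[a [<- <- <-]]]; exists a => //.
Qed.

Let latin (u : arc D -> syms D) :
    (forall a b, left_of a = left_of b -> u a = u b -> a = b) ->
    (forall a b, right_of a = right_of b -> u a = u b -> a = b) ->
    (forall x, exists a, u a = x) ->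
  partial_latin_square [set: rows D] [set: cols D] [set: syms D] (triples u).
Proof.
move=> lu ru su; split.
- by move=> r c s _; rewrite !in_setT.
- move=> _ _ /imsetP[a _ ->] /imsetP[b _ ->] ne; rewrite /agreements /=.
  have {ne} /eqP ne : a != b by apply: contraNneq ne => ->.
  case: (eqVneq (left_of a)) => [l|_]; case: (eqVneq (right_of a)) => [r|_];
    case: (eqVneq (u a)) => [t|_] //; case: ne; eauto.
- split=> x _.
  + have [a <-] := row_used D0 x; exists (right_of a), (u a).
    by apply/triplesP; exists a.
  + have [a <-] := col_used D0 x; exists (left_of a), (u a).
    by apply/triplesP; exists a.
  + have [a <-] := su x; exists (left_of a), (right_of a).
    by apply/triplesP; exists a.
Qed.

(** The mate with another symbol is the other end of the same arc. The two others come from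
    neighbouring arcs on the common face; by [simple] they cannot share the other face too, since
    the arcs would coincide and [u], [v] would agree there. *)
Let mates_triples (u v : arc D -> syms D) :
    (forall a b, left_of a = left_of b -> v a = v b -> a = b) ->
    (forall a b, right_of a = right_of b -> v a = v b -> a = b) ->
    (forall a, exists2 b, left_of b = left_of a & v b = u a) ->
    (forall a, exists2 b, right_of b = right_of a & v b = u a) ->
    (forall a, u a <> v a) ->
  mates (triples u) (triples v).
Proof.
move=> lv rv lp rp uv r c s /triplesP[a [<- <- <-]]; split.
- have [b rb vb] := rp a; exists (left_of b); split.
    split; last by apply/triplesP; exists b.
    by apply/eqP => /simple/(_ rb) ba; apply: (uv a); rewrite -vb ba.
  by move=> _ [_ /triplesP[d [<- rd vd]]]; rewrite (rv d b) ?rd ?vd.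
- have [b lb vb] := lp a; exists (right_of b); split.
    split; last by apply/triplesP; exists b.
    by apply/eqP => /(simple lb) ba; apply: (uv a); rewrite -vb ba.
  by move=> _ [_ /triplesP[d [ld <- vd]]]; rewrite (lv d b) ?ld ?vd.
- exists (v a); split; first by split; [apply/eqP/nesym|apply/triplesP;
    exists a].
  by move=> _ [_ /triplesP[d [ld rd <-]]]; rewrite (simple ld rd).
Qed.

Let arc_exists : exists a : arc D, True.
Proof.
have /card_gt0P[x _] : 0 < #|{: rows D + cols D + syms D}|.
  by rewrite !card_sum (euler D0) addn2.
case: x => [[x|x]|x].
- by have [a _] := row_used D0 x; exists a.
- by have [a _] := col_used D0 x; exists a.
- by have [a _] := sym_used D0 x; exists a.
Qed.

Lemma net_bitrade :
  latin_bitrade [set: rows D] [set: cols D] [set: syms D] (white D) (black D).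
Proof.
split.
- by apply: latin; [exact: left_tail_inj|exact: right_tail_inj|exact: sym_used].
- apply: latin; [exact: left_head_inj|exact: right_head_inj|] => x.
  have [a <-] := sym_used D0 x; have [b [_ <-]] := left_pred D0 a.
  by exists b.
- have [a] := arc_exists.
  by split; apply/set0Pn; [exists (left_of a, right_of a, tail a)
    | exists (left_of a, right_of a, head a)]; apply/triplesP; exists a.
- split; apply: mates_triples.
  + exact: left_head_inj.
  + exact: right_head_inj.
  + by move=> a; have [b []] := left_pred D0 a; exists b.
  + by move=> a; have [b []] := right_pred D0 a; exists b.
  + exact: loopless.
  + exact: left_tail_inj.
  + exact: right_tail_inj.
  + by move=> a; have [b []] := left_succ D0 a; exists b.
  + by move=> a; have [b []] := right_succ D0 a; exists b.
  + by move=> a /esym; apply: loopless.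
Qed.

(** The arcs whose white triple lies in [W] are closed under steps in both directions, because mates
    inside the sub-bitrade are also triples of [D] and there the arc is determined. Since the
    digraph is linked, these are all arcs, so [W] is not proper. *)
Lemma net_connected : connected_bitrade (white D) (black D).
Proof.
case=> ? [? [? [W [B [lat /properP[WD [w wD wW]] /properP[BD _]]]]]].
have [_ _ [W0 _] [WB BW]] := lat.
pose X a := (left_of a, right_of a, tail a) \in W.
have inW r c s : (r, c, s) \in W -> exists a, [/\ left_of a = r,
  right_of a = c & tail a = s].
  by move/(subsetP WD)/triplesP.
have inB r c s : (r, c, s) \in B -> exists a, [/\ left_of a = r,
  right_of a = c & head a = s].
  by move/(subsetP BD)/triplesP.
have Xhead a : X a -> (left_of a, right_of a, head a) \in B.
  case/WB=> _ _ [s [[_ sB] _]]; have [b [lb rb hb]] := inB _ _ _ sB.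
  by rewrite -(simple lb rb) lb rb hb.
have headX a : (left_of a, right_of a, head a) \in B -> X a.
  case/BW=> _ _ [s [[_ sW] _]]; have [b [lb rb hb]] := inW _ _ _ sW.
  by rewrite -(simple lb rb) /X lb rb hb.
have XS a b : step a b -> (X a <-> X b).
  move=> [[l h]|[r h]]; split.
  - case/Xhead/BW=> _ [c [[_ cW] _]] _; have [d [ld rd td]] := inW _ _ _ cW.
    rewrite -(left_tail_inj D0 (a := d) (b := b)) ?ld ?td //.
    by rewrite /X ld rd td.
  - case/WB=> _ [c [[_ cB] _]] _; have [d [ld rd hd]] := inB _ _ _ cB.
    rewrite -(left_head_inj D0 (a := d) (b := a)) ?ld ?hd //.
    by apply: headX; rewrite ld rd hd.
  - case/Xhead/BW=> [[c [[_ cW] _]] _ _]; have [d [ld rd td]] := inW _ _ _ cW.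
    rewrite -(right_tail_inj D0 (a := d) (b := b)) ?rd ?td //.
    by rewrite /X ld rd td.
  - case/WB=> [[c [[_ cB] _]] _ _]; have [d [ld rd hd]] := inB _ _ _ cB.
    rewrite -(right_head_inj D0 (a := d) (b := a)) ?rd ?hd //.
    by apply: headX; rewrite ld rd hd.
have /set0Pn[[[r c] s] rcsW] := W0; have [a [la ra ta]] := inW _ _ _ rcsW.
have /imsetP[b _ wE] := wD; have [ab] := net_linked D0 a b.
case/negP: wW; rewrite wE; apply: (ab X) => //.
by rewrite /X la ra ta.
Qed.

(** The permutation of a row is the successor on the left face, that of a column the predecessor on
    the right face, and that of a symbol the turn [rs \o lp] around the vertex; each is a single
    cycle by the corresponding linkedness field. *)
Lemma net_separated : separated_bitrade (white D) (black D).
Proof.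
have /choice[lp lpP] := left_pred D0; have /choice[rp rpP] := right_pred D0.
have /choice[ls lsP] := left_succ D0; have /choice[rs rsP] := right_succ D0.
split.
- move=> x; have [a0 xE] := row_used D0 x; rewrite /separated_row.
  have -> : row_symbols (white D) x = tail @: [set a | left_of a == x].
    apply/setP=> s; rewrite inE; apply/existsP/imsetP =>
      [[c /triplesP[a [l r t]]]|].
      by exists a; rewrite ?inE ?l.
    by case=> a; rewrite inE => /eqP <- ->; exists (right_of a);
      apply/triplesP; exists a.
  apply: (@single_cycle_imset _ _ _ _ ls _ _ _ a0).
  + by move=> a; have [] := lsP a; rewrite !inE => ->.
  + move=> a b ab; have [la ha] := lsP a; have [lb hb] := lsP b.
    by apply: (left_head_inj D0); rewrite ?la ?lb ?ha ?hb ab.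
  + move=> a b; rewrite !inE => /eqP <- /eqP /esym; exact: left_tail_inj.
  + by rewrite inE xE.
  + move=> a b; rewrite !inE => /eqP <- /eqP /esym /(row_linked D0).
    apply: (linked_map (f := id)) => c d [l h] ; apply: linked_step.
    have [lc hc] := lsP c.
    by apply: (left_tail_inj D0); rewrite -?lc -?hc.
  move=> a b; rewrite !inE => /eqP la /eqP lb; have [_ <-] := lsP a; split.
    case=> c [/triplesP[d [ld rd td]] /triplesP[d' [ld' rd' <-]]].
    rewrite -(left_tail_inj D0 _ td) ?la ?ld //; congr head.
    by apply: simple; rewrite ?ld' ?rd'.
  by move=> tb; exists (right_of a); split; apply/triplesP; exists a.
- move=> x; have [a0 xE] := col_used D0 x; rewrite /separated_column.
  have -> : column_rows (white D) x = left_of @: [set a | right_of a == x].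
    apply/setP=> s; rewrite inE; apply/existsP/imsetP =>
      [[c /triplesP[a [l r t]]]|].
      by exists a; rewrite ?inE ?r.
    by case=> a; rewrite inE => /eqP <- ->; exists (tail a); apply/triplesP;
      exists a.
  apply: (@single_cycle_imset _ _ _ _ rp _ _ _ a0).
  + by move=> a; have [] := rpP a; rewrite !inE => ->.
  + move=> a b ab; have [la ha] := rpP a; have [lb hb] := rpP b.
    by apply: (right_tail_inj D0); rewrite -?la -?lb -?ha -?hb ab.
  + by move=> a b; rewrite !inE => /eqP <- /eqP /esym r l; apply: simple.
  + by rewrite inE xE.
  + move=> a b; rewrite !inE => /eqP <- /eqP /esym /(col_linked D0).
    apply: (linked_map (f := id)) => c d [l h]; apply/linked_sym/linked_step.
    have [ld hd] := rpP d.
    by apply: (right_head_inj D0); rewrite ?ld ?hd.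
  move=> a b; rewrite !inE => /eqP ra /eqP rb; have [rpa hpa] := rpP a; split.
    case=> s [/triplesP[d [ld rd td]] /triplesP[d' [<- rd' hd']]].
    congr left_of; apply: (right_head_inj D0);
      rewrite ?rd' ?rpa ?ra // hpa hd' -td.
    by congr tail; apply: simple; rewrite ?ld ?rd.
  move=> ->; exists (tail a); split; apply/triplesP; first by exists a.
  by exists (rp a); rewrite rpa.
- move=> x; have [a0 xE] := sym_used D0 x; rewrite /separated_symbol.
  have -> : symbol_columns (white D) x = right_of @: [set a | tail a == x].
    apply/setP=> s; rewrite inE; apply/existsP/imsetP =>
      [[c /triplesP[a [l r t]]]|].
      by exists a; rewrite ?inE ?t.
    by case=> a; rewrite inE => /eqP <- ->; exists (left_of a); apply/triplesP;
      exists a.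
  have nextP a : [/\ left_of (lp a) = left_of a,
    right_of (rs (lp a)) = right_of (lp a),
      head (lp a) = tail a & tail (rs (lp a)) = tail a].
    have [l h] := lpP a; have [r t] := rsP (lp a).
    by rewrite -?r -?t -?h.
  apply: (@single_cycle_imset _ _ _ _ (rs \o lp) _ _ _ a0).
  + by move=> a; have [_ _ _ t] := nextP a; rewrite !inE t.
  + move=> a b /= ab; have [la ra ha ta] := nextP a;
      have [lb rb hb tb] := nextP b.
    have pab : lp a = lp b by apply: (right_head_inj D0);
      rewrite -?ra -?rb ?ha ?hb -?ta -?tb ab.
    by apply: (left_tail_inj D0); rewrite -?la -?lb -?ha -?hb pab.
  + by move=> a b; rewrite !inE => /eqP <- /eqP /esym r l;
      apply: (right_tail_inj D0).
  + by rewrite inE xE.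
  + move=> a b; rewrite !inE => /eqP <- /eqP /esym /(sym_linked D0).
    apply: (linked_map (f := id)) => c d [i [li hi] [ri h'i]];
      apply/linked_step => /=.
    have [lc rc hc tc] := nextP c.
    have ic : i = lp c by apply: (left_head_inj D0); rewrite ?lc ?hc.
    by apply: (right_tail_inj D0); [rewrite -ri rc ic | rewrite tc -h'i ic hc].
  move=> a b; rewrite !inE => /eqP ta /eqP tb; have [la ra ha t'a] := nextP a;
    split=> /=.
    case=> r [/triplesP[d [ld rd td]] /triplesP[d' [ld' <- hd']]].
    rewrite ra; congr right_of; apply: (left_head_inj D0);
      last by rewrite hd' ha ta.
    rewrite la ld' -ld; congr left_of; apply: (right_tail_inj D0);
      by rewrite ?rd ?ta ?td.
  move=> ->; exists (left_of a); split; apply/triplesP; first by exists a.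
  by exists (lp a); rewrite la ra ha ta.
Qed.

Let corner_pairs (z : arc D * 'I_3) : {set rows D + cols D + syms D} :=
  let: (a, i) := z in
  match val i with
  | 0 => [set inl (inl (left_of a)); inl (inr (right_of a))]
  | 1 => [set inl (inl (left_of a)); inr (tail a)]
  | _ => [set inl (inr (right_of a)); inr (tail a)]
  end.

(** Any two of left face, right face and tail determine the arc. So every edge lies in exactly one
    white triangle, and there are three edges per arc. *)
Let corner_pairs_inj : injective corner_pairs.
Proof.
move=> [a [[|[|[|//]]] ?]] [b [[|[|[|//]]] ?]] /= /setP E;
  have := (E (inl (inl (left_of a))), E (inl (inr (right_of a))),
    E (inr (tail a)));
  rewrite !inE /= ?eqxx ?orbT ?orbF /=; move=> [[e1 e2] e3]; try by [].
- case/esym/eqP: e1 => l; case/esym/eqP: e2 => r; congr pair;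
    last exact: val_inj.
  exact: simple.
- case/esym/eqP: e1 => l; case/esym/eqP: e3 => t; congr pair;
    last exact: val_inj.
  exact: (left_tail_inj D0).
- case/esym/eqP: e2 => r; case/esym/eqP: e3 => t; congr pair;
    last exact: val_inj.
  exact: (right_tail_inj D0).
Qed.

Let edges_white : edges (white D) = corner_pairs @: [set: arc D * 'I_3].
Proof.
apply/setP=> E; rewrite inE; apply/andP/imsetP => [[/cards2P[x [y [xy ->]]]]|].
  case/exists_inP=> _ /imsetP[a _ ->]; rewrite subUset !sub1set !inE.
  have i_in i : (a, i) \in [set: arc D * 'I_3] by rewrite inE.
  pose i0 := @Ordinal 3 0 isT; pose i1 := @Ordinal 3 1 isT;
    pose i2 := @Ordinal 3 2 isT.
  case/andP=> /orP[/orP[]|] /eqP xE /orP[/orP[]|] /eqP yE;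
    rewrite xE yE ?eqxx // in xy *.
  - by exists (a, i0).
  - by exists (a, i1).
  - by exists (a, i0) => //; rewrite setUC.
  - by exists (a, i2).
  - by exists (a, i1) => //; rewrite setUC.
  - by exists (a, i2) => //; rewrite setUC.
move=> [[a i] _ ->]; split.
  by case: i => [[|[|[|//]]] ?] /=; rewrite cards2.
apply/exists_inP; exists (left_of a, right_of a, tail a); first exact: imset_f.
by case: i => [[|[|[|//]]] ?] /=; rewrite subUset !sub1set !inE !eqxx ?orbT.
Qed.

Let card_edges_white : #|edges (white D)| = #|arc D| * 3.
Proof.
by rewrite edges_white card_imset // cardsT card_prod card_ord.
Qed.

Let corners_inj : injective (@corners (rows D) (cols D) (syms D)).
Proof.
move=> [[r c] s] [[r' c'] s'] /setP E.
have := (E (inl (inl r)), E (inl (inr c)), E (inr s)).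
rewrite !inE /= !eqxx ?orbT ?orbF /=; move=> [[/esym/eqP[->] /esym/eqP[->]]].
by move=> /esym/eqP[->].
Qed.

(** With N arcs the sum is (N + 2) - 3 N + 2 N. *)
Lemma net_euler : (euler_characteristic (white D) (black D) = 2)%R.
Proof.
rewrite /euler_characteristic card_edges_white /white_faces /black_faces.
rewrite !(card_imset _ corners_inj) !card_imset.
- rewrite cardsT !card_sum (euler D0) -!natz.
  rewrite !natrD natrM; ring.
- move=> a b [l r _]; exact: simple.
- move=> a b [l r _]; exact: simple.
Qed.

Lemma net_spherical : spherical_bitrade (white D) (black D).
Proof.
split; [exact: net_bitrade | exact: net_connected | exact: net_separated
  | exact: net_euler].
Qed.

End Spherical.

Local Open Scope ring_scope.

(** * Abelian groups presented by weighted digraphs *)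

(** Reflection for identities in abelian groups: both sides are compared through the integer
    coefficients of their atoms. *)
Inductive zexp :=
  | ZVar of nat | ZZero | ZAdd of zexp & zexp | ZOpp of zexp.

Fixpoint zeval (H : zmodType) (env : seq H) (e : zexp) : H :=
  match e with
  | ZVar i => env`_i
  | ZZero => 0
  | ZAdd e1 e2 => zeval env e1 + zeval env e2
  | ZOpp e => - zeval env e
  end.

Fixpoint zcoef (e : zexp) (i : nat) : int :=
  match e with
  | ZVar j => if j == i then 1 else 0
  | ZZero => 0
  | ZAdd e1 e2 => zcoef e1 i + zcoef e2 i
  | ZOpp e => - zcoef e i
  end.

Lemma zevalE (H : zmodType) (env : seq H) e :
  zeval env e = \sum_(i < size env) env`_i *~ zcoef e i.
Proof.
elim: e => [j||e1 IH1 e2 IH2|e IH] /=.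
- case: (ltnP j (size env)) => [j_lt|j_ge].
    rewrite (bigD1 (Ordinal j_lt)) //= eqxx mulr1z big1 ?addr0 // => i.
    by rewrite -val_eqE /= eq_sym => /negPf ->.
  rewrite nth_default // big1 // => i _.
  by case: eqP => // ji; have := ltn_ord i; rewrite -ji ltnNge j_ge.
- by rewrite big1.
- by rewrite IH1 IH2 -big_split; apply: eq_bigr => i _; rewrite mulrzDr.
- by rewrite IH -sumrN; apply: eq_bigr => i _; rewrite mulrNz.
Qed.

Lemma zeval_eq (H : zmodType) (env : seq H) e1 e2 :
  all (fun i => zcoef e1 i == zcoef e2 i) (iota 0 (size env)) ->
  zeval env e1 = zeval env e2.
Proof.
move=> /allP E; rewrite !zevalE; apply: eq_bigr => i _.
by rewrite (eqP (E i _)) // mem_iota ltn_ord.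
Qed.

(* Atoms are compared up to conversion: the same term may occur with
   different canonical structure paths. *)
Ltac zmod_index x l :=
  match l with
  | ?y :: _ => let _ := match goal with _ => unify x y end in constr:(0%N)
  | _ :: ?l => let n := zmod_index x l in constr:(n.+1)
  end.
Ltac zmod_mem x l :=
  match l with
  | ?y :: _ => let _ := match goal with _ => unify x y end in constr:(true)
  | _ :: ?l => zmod_mem x l
  | _ => constr:(false)
  end.
Ltac zmod_atoms t l :=
  lazymatch t with
  | ?a + ?b => let l := zmod_atoms a l in zmod_atoms b l
  | - ?a => zmod_atoms a l
  | 0 => l
  | _ => lazymatch zmod_mem t l with true => l | false => constr:(t :: l) end
  end.
Ltac zmod_reify t l :=
  lazymatch t with
  | ?a + ?b =>
      let a := zmod_reify a l in let b := zmod_reify b l in constr:(ZAdd a b)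
  | - ?a => let a := zmod_reify a l in constr:(ZOpp a)
  | 0 => constr:(ZZero)
  | _ => let n := zmod_index t l in constr:(ZVar n)
  end.
Ltac zmod :=
  lazymatch goal with
  | |- @eq ?T ?a ?b =>
      let l := zmod_atoms a (@nil T) in let l := zmod_atoms b l in
      let ea := zmod_reify a l in let eb := zmod_reify b l in
      exact: (@zeval_eq _ l ea eb isT)
  end.

(** For linear consequences: the equation [l = r] is a combination of known ones, built with [eqD]
    and [eqN], and the remaining condition is a formal identity for [zmod]. *)
Lemma zlin (H : zmodType) (x y l r : H) : l = r -> x - y = l - r -> x = y.
Proof. by move=> -> /eqP; rewrite subrr subr_eq0 => /eqP. Qed.

Definition eqD (H : zmodType) (x y z t : H) (E1 : x = y) (E2 : z = t) :
  x + z = y + t := congr2 +%R E1 E2.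
Definition eqN (H : zmodType) (x y : H) (E : x = y) : - x = - y := congr1 -%R E.

Section AdditiveOf.

Variables (U V : zmodType) (f : U -> V).
Hypothesis f_add : {morph f : x y / x + y >-> x + y}.

Definition additive_fun := f.

Fact additive_fun_sub : zmod_morphism additive_fun.
Proof.
move=> x y; apply: (addIr (f y)).
by rewrite /additive_fun -f_add !subrK.
Qed.

HB.instance Definition _ :=
  GRing.isZmodMorphism.Build U V additive_fun additive_fun_sub.

Definition additive_of : {additive U -> V} := additive_fun.

End AdditiveOf.

Lemma additive_ofE (U V : zmodType) (f : U -> V) (fD : {morph f : x y / x + y})
  x :
  additive_of fD x = f x.
Proof. by []. Qed.

Section CyclicLift.

Variables (M H : zmodType) (F : {additive M -> H}) (m : nat) (z : H).
Hypotheses (m_gt1 : (1 < m)%N) (mz : z *+ m = 0).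

(** Since [m] kills [z], multiples of [z] may be taken at any representative modulo [m]. The bound
    [1 < m] ensures that the truncated modulus inside ['Z_m] is [m] itself. *)
Fact cyclic_lift_add :
  {morph (fun x : M * 'Z_m => F x.1 + z *+ x.2) : x y / x + y >-> x + y}.
Proof.
have mod_m k : z *+ (k %% (Zp_trunc m).+2) = z *+ k.
  by rewrite Zp_cast // {2}(divn_eq k m) mulrnDr mulnC mulrnA mz mul0rn add0r.
by move=> [x i] [y j] /=; rewrite raddfD mod_m mulrnDr; zmod.
Qed.

Definition cyclic_lift : {additive M * 'Z_m -> H} := additive_of
  cyclic_lift_add.

Lemma cyclic_liftE x k : cyclic_lift (x, k) = F x + z *+ k.
Proof. by []. Qed.

Lemma cyclic_lift_nat x k : cyclic_lift (x, k%:R) = F x + z *+ k.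
Proof.
rewrite cyclic_liftE; congr (_ + _).
by rewrite val_Zp_nat // {2}(divn_eq k m) mulrnDr mulnC mulrnA mz mul0rn add0r.
Qed.

Lemma cyclic_lift0 x : cyclic_lift (x, 0) = F x.
Proof. by rewrite cyclic_liftE mulr0n addr0. Qed.

End CyclicLift.

Fact pair_inl_add (M N : zmodType) :
  {morph (fun x : M => (x, 0 : N)) : x y / x + y >-> x + y}.
Proof. by move=> x y; congr pair; rewrite addr0. Qed.
Definition pair_inl (M N : zmodType) : {additive M -> M * N} :=
  additive_of (@pair_inl_add M N).

Lemma pair_mulrn (M N : zmodType) (x : M * N) n :
  x *+ n = (x.1 *+ n, x.2 *+ n).
Proof.
elim: n => [|n IH]; first by rewrite !mulr0n.
by rewrite !mulrS IH.
Qed.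

(** * Solutions of the relations, and universal solutions *)

Record valuation (D : net) (M H : zmodType) := Valuation {
  row_val : rows D -> H; col_val : cols D -> H; sym_val : syms D -> H;
  mod_val : {additive M -> H} }.

Definition defect D M H (v : valuation D M H) (a : arc D) : H :=
  row_val v (left_of a) + col_val v (right_of a) + sym_val v (tail a).

(* An arc a of weight c a stands for a bundle of c a + 1 arcs parallel to a
   alternating with c a opposite arcs, twisted by the element eta a of the
   auxiliary group M. *)
Definition obeys (D : net) (M H : zmodType) (c : arc D -> nat) (eta : arc D ->
  M)
    (v : valuation D M H) : Prop :=
  forall a, defect v a
    = (sym_val v (head a) - sym_val v (tail a)) *+ c a + mod_val v (eta a).

Definition transports (D : net) (M G H : zmodType) (g : {additive G -> H})
    (v : valuation D M G) (v' : valuation D M H) : Prop :=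
  [/\ forall x, g (row_val v x) = row_val v' x,
      forall x, g (col_val v x) = col_val v' x,
      forall x, g (sym_val v x) = sym_val v' x
    & forall m, g (mod_val v m) = mod_val v' m].

Definition kills (D : net) (M G H : zmodType) (g : {additive G -> H})
    (v : valuation D M G) : Prop :=
  [/\ forall x, g (row_val v x) = 0, forall x, g (col_val v x) = 0,
      forall x, g (sym_val v x) = 0 & forall m, g (mod_val v m) = 0].

(** A universal property in place of a quotient: [v] is a universal solution. Uniqueness of the
    factorization is put as the vanishing of every map that kills [v], to be applied to a difference
    of two maps. *)
Definition presents (D : net) (M : zmodType) (c : arc D -> nat)
    (eta : arc D -> M) (G : zmodType) : Prop :=
  exists v : valuation D M G,
    [/\ obeys c eta v,
        forall (H : zmodType) (v' : valuation D M H), obeys c eta v' ->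
          exists g : {additive G -> H}, transports g v v'
      & forall (H : zmodType) (g : {additive G -> H}), kills g v ->
          forall x, g x = 0].

(* Solutions on D1 restrict to solutions on D, so both have the same universal
   solution up to extension by up. *)
Lemma presents_move (D D1 : net) (M M1 G : zmodType) c eta c1 eta1
    (up : valuation D M G -> valuation D1 M1 G) :
  (forall v, obeys c eta v -> obeys c1 eta1 (up v)) ->
  (forall v, obeys c eta v -> forall (H : zmodType) (v1 : valuation D1 M1 H),
    obeys c1 eta1 v1 -> exists2 v' : valuation D M H, obeys c eta v' &
      forall g : {additive G -> H},
        transports g v v' -> transports g (up v) v1) ->
  (forall v, obeys c eta v -> forall (H : zmodType) (g : {additive G -> H}),
    kills g (up v) -> kills g v) ->
  presents c eta G -> presents c1 eta1 G.
Proof.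
move=> upP downP killP [v [vP vU vG]]; exists (up v); split.
- exact: upP.
- move=> H v1 /(downP v vP)[v' /vU[g gv] gP]; exists g; exact: gP.
- by move=> H g /(killP v vP)/vG.
Qed.

(** * The effect of the moves on the presented group *)

Section TripleGroup.

Variables (D : net) (e : arc D) (M : zmodType) (c : arc D -> nat).
Variables (eta : arc D -> M) (eta1 eta2 eta3 : M) (k : nat).
Variables (c' : arc (triple e) -> nat) (eta' : arc (triple e) -> M).
Hypotheses (c_e : c e = k.+1) (eta_e : eta e = eta1 - eta2 + eta3)
  (c'_old : forall a, a != e -> c' (Some (Some a)) = c a)
  (eta'_old : forall a, a != e -> eta' (Some (Some a)) = eta a)
  (c'1 : c' None = 0%N) (c'2 : c' (Some None) = 0%N) (c'3 : c' (Some (Some e))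
    = k)
  (eta'1 : eta' None = eta1) (eta'2 : eta' (Some None) = eta2)
  (eta'3 : eta' (Some (Some e)) = eta3).

(** The relations of [None] and [Some None] force the values [nc] and [nr] of the new column and
    row. Adding the first and third relations and subtracting the second eliminates both and yields
    the old relation of [e], of weight k + 1 and twist [eta1 - eta2 + eta3]. *)
Lemma triple_presents G : presents c eta G -> presents c' eta' G.
Proof.
pose nc H (v : valuation D M H) := mod_val v eta1 - row_val v (left_of e) -
  sym_val v (tail e).
pose nr H (v : valuation D M H) := mod_val v eta2 - nc H v - sym_val v (head e).
apply: (presents_move (up := fun v : valuation D M G =>
  @Valuation (triple e) M G (fun x => oapp (row_val v) (nr G v) x)
    (fun x => oapp (col_val v) (nc G v) x) (sym_val v) (mod_val v))).
- move=> v vP [[a|]|]; rewrite /defect /=.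
  + case: (eqVneq a e) => [->|ae] /=; last by rewrite c'_old ?eta'_old // -vP.
    have := vP e; rewrite c'3 eta'3 /defect c_e eta_e raddfD raddfB mulrS => E.
    by rewrite /nr /nc; apply: (zlin E); zmod.
  + by rewrite c'2 eta'2 mulr0n /nr; zmod.
  + by rewrite c'1 eta'1 mulr0n /nc; zmod.
- move=> v vP H v1 v1P.
  exists (@Valuation D M H (row_val v1 \o Some) (col_val v1 \o Some) (sym_val
    v1) (mod_val v1)).
    move=> a; rewrite /defect /=; case: (eqVneq a e) => [->|ae]; last first.
      by have := v1P (Some (Some a)); rewrite /defect /= (negPf ae) c'_old
        ?eta'_old.
    have := (v1P None, v1P (Some None), v1P (Some (Some e)));
      rewrite /defect /= eqxx.
    rewrite c'1 c'2 c'3 eta'1 eta'2 eta'3 c_e eta_e !mulr0n raddfD raddfB mulrS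
      => -[[E1 E2] E3].
    by apply: (zlin (eqD (eqD E1 (eqN E2)) E3)); zmod.
  move=> g [/= gr gc gs gm].
  have := (v1P None, v1P (Some None)); rewrite /defect /= c'1 c'2 eta'1 eta'2
    !mulr0n => -[E1 E2].
  have gnc : g (nc G v) = col_val v1 None.
    by rewrite !raddfB gr gs gm; apply: (zlin (eqN E1)); zmod.
  split=> [[x|]|[x|]|//|//] /=; [exact: gr| |exact: gc|exact: gnc].
  by rewrite /nr 2!raddfB gnc gs gm; apply: (zlin (eqN E2)); zmod.
- move=> v vP H g [gr gc gs gm]; split=> //= x; first exact: (gr (Some x)).
  exact: (gc (Some x)).
Qed.

End TripleGroup.

Section TwistGroup.

Variables (D : net) (e : arc D) (M : zmodType) (p : nat) (c : arc D -> nat).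
Variables (eta : arc D -> M * 'Z_p).
Variables (c' : arc (subdivide e) -> nat) (eta' : arc (subdivide e) -> M).
Hypotheses (p_gt1 : (1 < p)%N) (c_e : c e = 0%N) (eta_e : eta e = (0, 1))
  (eta_old : forall a, a != e -> (eta a).2 = 0)
  (c'_old : forall a, a != e -> c' (Some a) = c a)
  (eta'_old : forall a, a != e -> eta' (Some a) = (eta a).1)
  (c'1 : c' (Some e) = p.-1) (c'2 : c' None = 0%N)
  (eta'1 : eta' (Some e) = 0) (eta'2 : eta' None = 0).

Let Zp_order : (0, 1) *+ p = 0 :> M * 'Z_p.
Proof. by rewrite pair_mulrn /= mul0rn pchar_Zp. Qed.

(** Put h = l + r + x. The half [None] gives l + r + w = 0, so w - x = -h, and the half of weight p
    - 1 gives h = -(p - 1) h, that is p h = 0. Hence h plays the role of the generator of ['Z_p]. *)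
Lemma twist_presents G : presents c eta G -> presents c' eta' G.
Proof.
pose w H (M' : zmodType) (v : valuation D M' H) := - (row_val v (left_of e) +
  col_val v (right_of e)).
apply: (presents_move (up := fun v : valuation D (M * 'Z_p)%type G =>
  @Valuation (subdivide e) M G (row_val v) (col_val v)
    (fun x => oapp (sym_val v) (w G _ v) x) (mod_val v \o pair_inl M 'Z_p))).
- move=> v vP [a|]; rewrite /defect /=; last first.
    by rewrite c'2 eta'2 mulr0n raddf0 /w; zmod.
  case: (eqVneq a e) => [->|ae] /=; last first.
    rewrite c'_old // eta'_old //.
    by have := vP a; rewrite /defect => ->; congr (_ + mod_val v _);
      have := eta_old ae; case: (eta a) => ? ? /= ->.
  have := vP e; rewrite /defect c_e eta_e mulr0n add0r => E.
  rewrite E c'1 eta'1 raddf0 addr0.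
  have -> : w G _ v - sym_val v (tail e) = - mod_val v (0, 1).
    by rewrite /w -E; zmod.
  rewrite mulNrn; apply/eqP; rewrite -subr_eq0 opprK -mulrS prednK ?(ltnW
    p_gt1) //.
  by rewrite -raddfMn Zp_order raddf0.
- move=> v vP H v1 v1P.
  have := (v1P (Some e),
    v1P None); rewrite /defect /= eqxx c'1 c'2 eta'1 eta'2 mulr0n !raddf0
      !addr0 => -[E1 E2].
  pose z := sym_val v1 (Some (tail e)) - sym_val v1 None.
  have pz : z *+ p = 0.
    rewrite -(prednK (ltnW p_gt1)) mulrS; apply/eqP;
      rewrite addr_eq0 -mulNrn opprB -E1.
    by apply/eqP/(zlin (eqN E2)); rewrite /z; zmod.
  exists (@Valuation D (M * 'Z_p)%type H (row_val v1) (col_val v1) (sym_val v1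
    \o Some)
      (cyclic_lift (mod_val v1) p_gt1 pz)).
    move=> a; rewrite /defect /=; case: (eqVneq a e) => [->|ae].
      rewrite c_e eta_e mulr0n -[1]/(1%:R) cyclic_lift_nat // raddf0 !add0r.
      by rewrite /z mulr1n; apply: (zlin E2); zmod.
    have := v1P (Some a); rewrite /defect /= (negPf ae) c'_old // eta'_old //
      => ->.
    by rewrite -(cyclic_lift0 _ p_gt1 pz) -(eta_old ae); case: (eta a).
  move=> g [/= gr gc gs gm]; split=> //=.
    case=> [x|] /=; first exact: gs.
    by rewrite raddfN raddfD gr gc; apply: (zlin (eqN E2)); zmod.
  by move=> m; rewrite gm cyclic_lift0.
- move=> v vP H g [/= gr gc gs gm]; split=> //= [x|[m z]];
    first exact: (gs (Some x)).
  have g01 : g (mod_val v (0, 1)) = 0.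
    have := vP e; rewrite /defect c_e eta_e mulr0n add0r => <-.
    by rewrite !raddfD gr gc (gs (Some (tail e))) !addr0.
  have -> : (m, z) = pair_inl M 'Z_p m + (0, 1) *+ z.
    by rewrite pair_mulrn /= mul0rn Zp_nat valZpK; congr pair;
      rewrite ?addr0 ?add0r.
  by rewrite 2!raddfD gm add0r !raddfMn g01 mul0rn.
Qed.

End TwistGroup.

Section NestGroup.

Variables (D : net) (e : arc D).

(* With e from x to y, w and w' the new vertices: Some None and None form the
   path x, w', w; Some (Some None) goes from w back to x; nested_old e, from x
   to w, will carry the rest of the p-fold bundle; Some (Some (Some None)) goes
   from w to y. *)
Definition nested : net := @subdivide (@triple (subdivide e) (Some e)) None.

Definition nested_old (a : arc D) : arc nested := Some (Some (Some (Some a))).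

Variables (M : zmodType) (nu : M) (p q : nat) (c : arc D -> nat).
Variables (eta : arc D -> M * 'Z_(p * q)).
Variables (c' : arc nested -> nat) (eta' : arc nested -> M).
Hypotheses (p_gt1 : (1 < p)%N) (q_gt1 : (1 < q)%N) (p_nu : nu *+ p = 0)
  (c_e : c e = 0%N) (eta_e : eta e = (- nu, q%:R))
  (eta_old : forall a, a != e -> (eta a).2 = 0)
  (c'_old : forall a, a != e -> c' (nested_old a) = c a)
  (eta'_old : forall a, a != e -> eta' (nested_old a) = (eta a).1)
  (c'_e : c' (nested_old e) = (p - 2)%N) (c'_mark : c' None = q.-1)
  (c'_1 : c' (Some None) = 0%N) (c'_2 : c' (Some (Some None)) = 0%N)
  (c'_3 : c' (Some (Some (Some None))) = 0%N)
  (eta'_e : eta' (nested_old e) = 0) (eta'_mark : eta' None = nu)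
  (eta'_1 : eta' (Some None) = 0) (eta'_2 : eta' (Some (Some None)) = 0)
  (eta'_3 : eta' (Some (Some (Some None))) = 0).

Let m := (p * q)%N.
Let m_gt1 : (1 < m)%N. Proof. by rewrite /m; nia. Qed.

Let someE (a b : arc D) : (Some a == Some b :> arc (subdivide e)) = (a == b).
Proof. by []. Qed.

(** Put h = l + r + x. The arc from w to y gives w - x = -h. The arcs x to w' and w back to x
    determine [nc] and [nr] = l + h, so the old arc reads 2 h = -(p - 2) h, that is p h = 0. With z
    = w' - w, the marked half reads h = q z - nu. As p kills nu, the only condition left on z is p q
    z = 0, so z plays the generator of ['Z_(p * q)] and h is the twist of [e]. *)
Lemma nested_presents G : presents c eta G -> presents c' eta' G.
Proof.
pose h H (M' : zmodType) (v : valuation D M' H) := row_val v (left_of e) +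
  col_val v (right_of e) + sym_val v (tail e).
pose w H (M' : zmodType) (v : valuation D M' H) := - (row_val v (left_of e) +
  col_val v (right_of e)).
pose nc H (M' : zmodType) (v : valuation D M' H) := - (row_val v (left_of e) +
  sym_val v (tail e)).
pose nr H (M' : zmodType) (v : valuation D M' H) := row_val v (left_of e) + h H
  M' v.
apply: (presents_move (up := fun v : valuation D (M * 'Z_m)%type G =>
  @Valuation nested M G
    (fun x => oapp (row_val v) (nr G _ v) x) (fun x =>
      oapp (col_val v) (nc G _ v) x)
    (fun x => oapp (oapp (sym_val v) (w G _ v)) (w G _ v + mod_val v (0, 1)) x)
    (mod_val v \o pair_inl M 'Z_m))).
- move=> v vP; have := vP e; rewrite /defect c_e eta_e mulr0n add0r => E.
  have E' : mod_val v (0, 1) *+ q - mod_val v (nu, 0) = mod_val v (- nu, q%:R).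
    by rewrite -raddfMn -raddfB pair_mulrn mul0rn; congr (mod_val v (_, _));
      rewrite ?sub0r ?subr0.
  have ph : mod_val v (- nu, q%:R) *+ p = 0.
    rewrite -raddfMn pair_mulrn mulNrn p_nu oppr0 -mulrnA mulnC pchar_Zp //.
    exact: raddf0.
  move=> [[[[a|]|]|]|]; rewrite /defect /=.
  + have [->|ae] := eqVneq a e.
      rewrite -/(nested_old e) c'_e eta'_e /= eqxx /= raddf0 addr0.
      rewrite (_ : w G _ v - sym_val v (tail e) = - mod_val v (- nu, q%:R));
        last by rewrite /w -E; zmod.
      move: p_gt1 ph; case: (p) => [|[|k]] // _;
        rewrite !mulrSr subn2 mulNrn /= => ph.
      by apply: (zlin (eqD (eqD ph E) E)); rewrite /nr /h; zmod.
    rewrite -/(nested_old a) c'_old // eta'_old // someE /= (negPf ae) /=.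
    by have := vP a; rewrite /defect => ->; congr (_ + mod_val v _);
      have := eta_old ae; case: (eta a) => ? ? /= ->.
  + by rewrite c'_3 eta'_3 mulr0n raddf0 /w; zmod.
  + by rewrite c'_2 eta'_2 mulr0n raddf0 eqxx /= /nr /nc /w /h; zmod.
  + by rewrite c'_1 eta'_1 mulr0n raddf0 /nc; zmod.
  + rewrite c'_mark eta'_mark eqxx /=.
    rewrite (_ : w G _ v - _ = - mod_val v (0, 1)); last by zmod.
    move: (mod_val v (- nu, q%:R)) E E' => hh E; move: q_gt1;
      case: (q) => [|k] //= _; rewrite mulrS mulNrn => E'.
    by apply: (zlin (eqD (eqN E) E')); rewrite /nc /w; zmod.
- move=> v vP H v1 v1P.
  have E1 := v1P (Some None); have E2 := v1P None;
    have E3 := v1P (Some (Some None)).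
  have E4 := v1P (nested_old e); have E5 := v1P (Some (Some (Some None))).
  rewrite /defect /= in E1 E2 E3 E4 E5.
  rewrite ?eqxx c'_1 eta'_1 mulr0n raddf0 /= in E1.
  rewrite eqxx c'_mark eta'_mark /= in E2.
  rewrite eqxx c'_2 eta'_2 mulr0n raddf0 /= in E3.
  rewrite -/(nested_old e) someE eqxx c'_e eta'_e raddf0 /= in E4.
  rewrite c'_3 eta'_3 mulr0n raddf0 /= in E5.
  (* By [E5] the difference [x1 - w1] is the defect of [e] in the restricted solution: [p_xw] bounds
     its order and [q_z] expresses it through [z]. *)
  pose w1 := sym_val v1 (Some None); pose x1 := sym_val v1 (Some (Some (tail
    e))).
  pose z := sym_val v1 None - w1.
  have p_xw : (x1 - w1) *+ p = 0.
    move: p_gt1 E4; case: (p) => [|[|k]] // _; rewrite subn2 /= !mulrSr.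
    rewrite -/w1 -/x1 -(opprB x1) mulNrn => E4.
    by apply: (zlin (eqD (eqD E4 (eqN E3)) (eqD E1 (eqN E5))));
      rewrite /w1 /x1; zmod.
  have q_z : z *+ q - mod_val v1 nu = x1 - w1.
    move: q_gt1 E2; case: (q) => [|k] //= _; rewrite mulrSr.
    rewrite -/w1 -(opprB _ w1) -/z mulNrn => E2.
    by apply: (zlin (eqD E2 (eqN E1))); rewrite /z /w1 /x1; zmod.
  have pq_z : z *+ m = 0.
    have z_q : z *+ q = x1 - w1 + mod_val v1 nu by rewrite -q_z subrK.
    by rewrite /m mulnC mulrnA z_q mulrnDl p_xw -raddfMn p_nu raddf0 addr0.
  exists (@Valuation D (M * 'Z_m)%type H (row_val v1 \o Some) (col_val v1 \o
    Some)
     (fun x => sym_val v1 (Some (Some x))) (cyclic_lift (mod_val v1) m_gt1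
       pq_z)).
    move=> a; rewrite /defect /=; case: (eqVneq a e) => [->|ae].
      rewrite c_e eta_e mulr0n cyclic_lift_nat // raddfN add0r.
      by apply: (zlin (eqD E5 (eqN q_z))); rewrite /x1 /w1; zmod.
    have := v1P (nested_old a); rewrite /defect /= someE (negPf ae) /= c'_old
      // eta'_old // => ->.
    by rewrite -(cyclic_lift0 _ m_gt1 pq_z) -(eta_old ae); case: (eta a).
  move=> g [/= gr gc gs gm].
  have gw : g (w G _ v) = sym_val v1 (Some None).
    by rewrite raddfN raddfD gr gc; apply: (zlin (eqN E5)); zmod.
  split=> [[x|]|[x|]|[[x|]|]|x] /=; rewrite ?gr ?gc ?gs //.
  - by rewrite /nr /h !raddfD !gr gc gs; apply: (zlin (eqD (eqD E5 E1) (eqN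
      E3))); zmod.
  - by rewrite raddfN raddfD gr gs; apply: (zlin (eqN E1)); zmod.
  - rewrite raddfD gw gm -[1]/(1%:R) cyclic_lift_nat // raddf0 /z /w1 mulr1n.
      zmod.
  - by rewrite gm cyclic_lift0.
- move=> v vP H g [/= gr gc gs gm].
  have g01 : g (mod_val v (0, 1)) = 0.
    by have := gs None; have /= := gs (Some None);
      rewrite /= raddfD => -> /[!add0r].
  split=> [x|x|x|[x k]]; [exact: (gr (Some x))|exact: (gc (Some x))|exact: (gs
    (Some (Some x)))|].
  have -> : (x, k) = pair_inl M 'Z_m x + (0, 1) *+ k.
    by rewrite pair_mulrn /= mul0rn Zp_nat valZpK; congr pair;
      rewrite ?addr0 ?add0r.
  by rewrite 2!raddfD gm add0r !raddfMn g01 mul0rn.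
Qed.

End NestGroup.

(** Subdividing creates arcs with the same two faces. They are tolerated while one of them has
    positive weight, because unfolding its bundle will separate them by new faces; at weight zero
    everywhere the digraph is simple. *)
Definition simple_off (D : net) (c : arc D -> nat) : Prop :=
  forall a b : arc D, left_of a = left_of b -> right_of a = right_of b ->
    [\/ a = b, (0 < c a)%N | (0 < c b)%N].

Definition loopless (D : net) : Prop := forall a : arc D, tail a <> head a.

Lemma triple_simple D (e : arc D) c (c' : arc (triple e) -> nat) :
  simple_off c -> (forall a, a != e -> c' (Some (Some a)) = c a) ->
  simple_off c'.
Proof.
move=> sc c'E [[a|]|] [[b|]|] //=; try by constructor.
- case: (eqVneq a e) => [->|ae]; case: (eqVneq b e) => [->|be] //=;
    first by constructor.
  case=> l [r]; rewrite !c'E //; case: (sc a b l r) => [->| |]; by constructor.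
Qed.

(** An arc sharing both faces with [e] must have positive weight because [e] has none, so it is
    harmless beside both halves; the halves themselves need one positive weight between them. *)
Lemma subdivide_simple D (e : arc D) c (c' : arc (subdivide e) -> nat) :
  simple_off c -> c e = 0%N -> (forall a, a != e -> c' (Some a) = c a) ->
  (0 < c' (Some e) + c' None)%N -> simple_off c'.
Proof.
move=> sc ce c'E; rewrite addn_gt0 => /orP pos.
have old a : left_of a = left_of e -> right_of a = right_of e -> a = e \/ (0 <
  c' (Some a))%N.
  move=> l r; case: (eqVneq a e) => [->|ae]; first by left.
  by rewrite c'E //; case: (sc a e l r) => [|ca|]; [left|right|rewrite ce].
have eN : [\/ Some e = None, (0 < c' (Some e))%N | (0 < c' None)%N].
  by case: pos => pos; constructor.
move=> [a|] [b|] /= l r; last by constructor.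
- case: (eqVneq a e) l r => [->|ae] l r.
    by case: (old b) => // [->|?]; constructor.
  case: (eqVneq b e) l r => [->|be] l r.
    by case: (old a) => // [->|?]; constructor.
  by rewrite !c'E //; case: (sc a b l r) => [->| |]; constructor.
- by case: (old a) => // [->|?]; [exact: eN | constructor].
- case: (old b) => // [->|?]; last by constructor.
  by case: pos => pos; constructor.
Qed.

Lemma triple_loopless D (e : arc D) : loopless D -> loopless (triple e).
Proof. by move=> ll [[a|]|] /=; [exact: ll|move/esym; exact: ll|exact: ll]. Qed.

(** The arc [e] may be a loop: each of its halves has the new vertex as one end. *)
Lemma subdivide_loopless D (e : arc D) :
  (forall a, a != e -> tail a <> head a) -> loopless (subdivide e).
Proof. by move=> ll [a|] //=; case: (eqVneq a e) => // /ll ne [] /ne. Qed.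

Definition state (D : net) (M : zmodType) (c : arc D -> nat)
    (eta : arc D -> M) (G : zmodType) : Prop :=
  [/\ planar D, simple_off c, loopless D & presents c eta G].

(** * Moves on weighted, twisted digraphs *)

Section Moves.

Variables (D : net) (e : arc D) (M : zmodType) (c : arc D -> nat) (G :
  zmodType).

Definition triple_weight (k : nat) (a : arc (triple e)) : nat :=
  if a is Some (Some a) then if a == e then k else c a else 0%N.

Definition triple_mod (eta : arc D -> M) (eta1 eta2 eta3 : M) (a : arc (triple
  e)) : M :=
  match a with
  | None => eta1 | Some None => eta2
  | Some (Some a) => if a == e then eta3 else eta a end.

Lemma triple_state eta eta1 eta2 eta3 k :
  c e = k.+1 -> eta e = eta1 - eta2 + eta3 ->
  state c eta G -> state (triple_weight k) (triple_mod eta eta1 eta2 eta3) G.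
Proof.
move=> ce etae [D0 sc ll P]; split.
- exact: triple_planar.
- by apply: (triple_simple sc) => a /negPf ae; rewrite /= ae.
- exact: triple_loopless.
- apply: triple_presents P => //=; rewrite ?eqxx //;
    exact: ce || exact: etae || by move=> a /negPf ->.
Qed.

Definition twist_weight (p : nat) (a : arc (subdivide e)) : nat :=
  if a is Some a then if a == e then p.-1 else c a else 0%N.

Definition twist_mod (N : zmodType) (eta : arc D -> M * N) (a : arc (subdivide
  e)) : M :=
  if a is Some a then (eta a).1 else 0.

Lemma twist_state p (eta : arc D -> M * 'Z_p) :
  (1 < p)%N -> c e = 0%N -> eta e = (0, 1) -> (forall a,
    a != e -> (eta a).2 = 0) ->
  state c eta G -> state (twist_weight p) (twist_mod eta) G.
Proof.
move=> p_gt1 ce etae eta_old [D0 sc ll P]; split.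
- exact: subdivide_planar.
- apply: (subdivide_simple sc ce) => [a /negPf ae|]; rewrite /= ?ae //.
  by rewrite eqxx addn0; case: (p) p_gt1 => [|[]].
- by apply: subdivide_loopless => a _; apply: ll.
- apply: (twist_presents p_gt1 ce etae eta_old _ _ _ _ _ _ P) => //=;
    rewrite ?eqxx ?etae //.
  by move=> a /negPf ->.
Qed.

Definition nested_weight (p q : nat) (a : arc (nested e)) : nat :=
  match a with
  | None => q.-1
  | Some (Some (Some (Some a))) => if a == e then (p - 2)%N else c a
  | _ => 0%N
  end.

Definition nested_mod (N : zmodType) (eta : arc D -> M * N) (nu : M) (a : arc
  (nested e)) : M :=
  match a with
  | None => nu
  | Some (Some (Some (Some a))) => if a == e then 0 else (eta a).1
  | _ => 0
  end.

Lemma nested_state p q nu (eta : arc D -> M * 'Z_(p * q)) :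
  (1 < p)%N -> (1 < q)%N -> nu *+ p = 0 -> c e = 0%N -> eta e = (- nu, q%:R) ->
  (forall a, a != e -> (eta a).2 = 0) ->
  planar D -> simple_off c -> (forall a, a != e -> tail a <> head a) ->
  presents c eta G -> state (nested_weight p q) (nested_mod eta nu) G.
Proof.
move=> p_gt1 q_gt1 p_nu ce etae eta_old D0 sc ll P.
have ll1 := subdivide_loopless ll.
(* Weights of the two intermediate digraphs, introduced to follow [simple_off]; the presented group
   is treated in one go by [nested_presents]. *)
pose c1 : arc (subdivide e) -> nat := twist_weight p.
pose c2 : arc (triple (Some e : arc (subdivide e))) -> nat :=
  fun a => if a is Some (Some a) then if a == Some e then (p - 2)%N else c1 a
    else 0%N.
have sc1 : simple_off c1.
  apply: (subdivide_simple sc ce) => [a /negPf ae|]; rewrite /= ?ae //.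
  by rewrite eqxx addn0; case: (p) p_gt1 => [|[]].
have sc2 : simple_off c2.
  by apply: (triple_simple sc1) => a /negPf ae; rewrite /c2 ae.
split.
- by apply/subdivide_planar/triple_planar;
    [exact: ll1 | exact: subdivide_planar].
- apply: (subdivide_simple sc2) => //=.
    move=> [[[a|]|]|] //= _; rewrite /c2 /c1 /=.
    by rewrite (_ : (Some a == Some e) = (a == e)) //; case: (a == e).
  by rewrite -subn1 subn_gt0.
- by apply: subdivide_loopless => a _; apply/triple_loopless.
- apply: (nested_presents p_gt1 q_gt1 p_nu ce etae eta_old _ _ _ _ _ _ _ _ _ _
    _ _ P) => //=; rewrite ?eqxx //;
  by move=> a /negPf ->.
Qed.

End Moves.

(** * Realizable groups and removal of twists *)

Lemma pair_mulrz (M N : zmodType) (x : M * N) (n : int) :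
  x *~ n = (x.1 *~ n, x.2 *~ n).
Proof. by case: n => n; rewrite /intmul pair_mulrn. Qed.

(** With zero weights and twists and trivial [M], the relations are exactly r + c + s = 0 over the
    white triples. *)
Definition realized (G : zmodType) : Prop :=
  exists (D : net) (M : zmodType), (forall m : M, m = 0) /\
    @state D M (fun=> 0%N) (fun=> 0) G.

Lemma sum_option (T : finType) (F : option T -> nat) :
  (\sum_a F a = F None + \sum_a F (Some a))%N.
Proof.
rewrite (bigD1 None) //=; congr addn.
rewrite (reindex_omap (Some : T -> option T) id) //= => [|[]] //.
by apply: eq_bigl => a; rewrite /= eqxx.
Qed.

(** Once the twists are gone, bundles are unfolded one tripling at a time; each tripling lowers the
    total weight by one. *)
Lemma state_realized (M : zmodType) : (forall m : M, m = 0) ->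
  forall (D : net) (c : arc D -> nat) (eta : arc D -> M) G,
  state c eta G -> realized G.
Proof.
move=> M0 D c; move: {2}(\sum_a c a)%N (erefl (\sum_a c a)%N) => n.
elim: n => [|n IH] in D c *.
  move=> /eqP; rewrite sum_nat_eq0 => /forall_inP c0 eta G.
  rewrite (_ : c = fun=> 0%N); last by apply/funext => a; apply/eqP/c0.
  rewrite (_ : eta = fun=> 0); last by apply/funext => a; apply: M0.
  by exists D, M.
move=> sum_c eta G Dst.
have /exists_inP[e _ ce] : [exists a in arc D, (0 < c a)%N].
  apply: contraPT sum_c; rewrite negb_exists_in => /forall_inP c0.
  by rewrite big1 // => a _; have := c0 a isT; case: (c a).
have ceE : c e = (c e).-1.+1 by rewrite prednK.
have etaE : eta e = 0 - 0 + 0 by rewrite (M0 (eta e)) subrr addr0.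
apply: (IH _ _ _ _ _ (triple_state ceE etaE Dst)).
rewrite !sum_option /= !add0n.
rewrite (bigD1 e) //= eqxx; move: sum_c.
rewrite (bigD1 e) //= -[X in (X + _)%N](prednK ce) => -[<-].
by congr addn; apply: eq_bigr => a /negPf ->.
Qed.

Definition marked (D : net) (M : zmodType) (c : arc D -> nat) (eta : arc D -> M)
    (e : arc D) (nu : M) (k : nat) : Prop :=
  [/\ c e = k, eta e = nu & forall a, a != e -> eta a = 0].

(* A twist nu on one arc of weight k can be removed by further moves. *)
Definition realizable (M : zmodType) (nu : M) (k : nat) : Prop :=
  forall (D : net) (c : arc D -> nat) (eta : arc D -> M) e G,
    marked c eta e nu k -> state c eta G -> realized G.

(* As realizable with k = 0, but the marked arc may be a loop: this is needed to
   start from loop_net. *)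
Definition loop_realizable (M : zmodType) (nu : M) : Prop :=
  forall (D : net) (c : arc D -> nat) (eta : arc D -> M) e G,
    marked c eta e nu 0 -> planar D -> simple_off c ->
    (forall a, a != e -> tail a <> head a) -> presents c eta G -> realized G.

Lemma loop_realizable_realizable (M : zmodType) (nu : M) :
  loop_realizable nu -> realizable nu 0.
Proof.
by move=> R D c eta e G mk [D0 sc ll P]; apply: R mk _ _ _ P => // a _;
  apply: ll.
Qed.

Lemma realizable_trivial (M : zmodType) (nu : M) k :
  (forall m : M, m = 0) -> realizable nu k.
Proof. by move=> M0 D c eta e G _; apply: state_realized. Qed.

Section Realizable.

Variables (p : nat) (M : zmodType) (nu : M) (k : nat).
Hypotheses (p_gt1 : (1 < p)%N) (nuR : realizable nu k).

(** Unfolding one level of a bundle of weight k + 1 leaves weight [k] with twist [nu] on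
    [Some (Some e)], and two new arcs of weight 0. Here both stay untwisted; the next two lemmas
    twist one or both of them. *)
Lemma realizable_triple0 : realizable nu k.+1.
Proof.
move=> D c eta e G [ce etae eta0] Dst.
have etaE : eta e = 0 - 0 + nu by rewrite subrr add0r.
apply: (@nuR (triple e) _ _ (Some (Some e)) _ _ (triple_state ce etaE Dst)).
split=> /=; rewrite ?eqxx // => -[[a|]|] //= ae.
by have ne : a != e := ae; rewrite (negPf ne) eta0.
Qed.

Lemma realizable_triple1 : realizable ((nu, 1) : M * 'Z_p) k.+1.
Proof.
move=> D c eta e G [ce etae eta0] Dst.
have etaE : eta e = (0, 1) - 0 + (nu, 0) by rewrite etae; congr pair;
  rewrite /= ?subr0 ?addr0 ?add0r.
have := triple_state ce etaE Dst; set c1 := triple_weight _ _;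
  set eta1 := triple_mod _ _ _ _ => st1.
have := @twist_state (triple e) None M c1 G p eta1 p_gt1 erefl erefl _ st1.
move=> /(_ _)/wrap[|st2].
  move=> [[a|]|] //= _; case: eqP => // /eqP ae; by rewrite eta0.
apply: (@nuR (@subdivide (triple e) None) _ _ (Some (Some (Some e))) _ _ st2).
split=> /=; rewrite ?eqxx // => -[[[a|]|]|] //= ae.
by have ne : a != e := ae; rewrite (negPf ne) eta0.
Qed.

(** The backward arc carries the generator of the outer ['Z_p], and its twist enters the sum with a
    minus sign, hence the -1. *)
Lemma realizable_triple2 : realizable (((nu, 1), -1) : M * 'Z_p * 'Z_p) k.+1.
Proof.
move=> D c eta e G [ce etae eta0] Dst.
have etaE : eta e = ((0, 1), 0) - ((0, 0), 1) + ((nu, 0), 0).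
  by rewrite etae; congr (_, _, _); rewrite /= ?subr0 ?sub0r ?addr0 ?add0r.
have := triple_state ce etaE Dst; set c1 := triple_weight _ _;
  set eta1 := triple_mod _ _ _ _ => st1.
have := @twist_state (triple e) (Some None) _ c1 G p eta1 p_gt1 erefl erefl _
  st1.
move=> /(_ _)/wrap[|st2].
  move=> [[a|]|] //= _; case: eqP => // /eqP ae; by rewrite eta0.
have := @twist_state (@subdivide (triple e) (Some None)) (Some None) M _ G p _
  p_gt1 erefl erefl _ st2.
move=> /(_ _)/wrap[|st3].
  move=> [[[a|]|]|] //= _; case: eqP => // /eqP ae; by rewrite eta0.
apply: (@nuR (@subdivide (@subdivide (triple e) (Some None)) (Some None)) _ _
  (Some (Some (Some (Some e)))) _ _ st3).
split=> /=; rewrite ?eqxx // => -[[[[a|]|]|]|] //= ae.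
by have ne : a != e := ae; rewrite (negPf ne) eta0.
Qed.

(** The nested move absorbs this twist and leaves [nu] on an inner bundle of weight [k], where the
    assumption on [nu] takes over; k + 1 is the number of forward arcs there. *)
Lemma realizable_nested : (1 <= k)%N -> nu *+ p = 0 ->
  loop_realizable ((- nu, k.+1%:R) : M * 'Z_(p * k.+1)).
Proof.
move=> k_gt0 p_nu D c eta e G [ce etae eta0] D0 sc ll P.
have eta2 a : a != e -> (eta a).2 = 0 by move/eta0->.
apply: (@nuR (nested e) _ _ None _ _ (nested_state p_gt1 _ p_nu ce etae eta2 D0
  sc ll P)) => //.
split=> //= -[[[[a|]|]|]|] //= _.
by case: eqP => // /eqP ae; rewrite eta0.
Qed.

End Realizable.

(** Accounts for the summand 1 in the bound on n: the one arc left at weight 0 in the last bundle is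
    twisted too. *)
Lemma realizable_twist p (M : zmodType) : (1 < p)%N -> (forall m : M, m = 0) ->
  realizable ((0, 1) : M * 'Z_p) 0.
Proof.
move=> p_gt1 M0 D c eta e G [ce etae eta0] st.
have eta2 a : a != e -> (eta a).2 = 0 by move/eta0->.
exact: state_realized M0 _ _ _ _ (twist_state p_gt1 ce etae eta2 st).
Qed.

Definition loop_net : net :=
  @Net unit unit unit unit id id id id.

(** For a single loop on the sphere the relation l + r + x = nu eliminates x, so the group is [M]
    plus the free group on the two faces l and r. *)
Lemma loop_realized (M : zmodType) (nu : M) :
  loop_realizable nu -> realized (M * (int * int))%type.
Proof.
move=> R; pose c (_ : arc loop_net) := 0%N; pose eta (_ : arc loop_net) := nu.
apply: (R loop_net c eta tt) => //.
- split=> //=; try by move=> [] //; exists tt.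
  + by move=> [] [] _; apply: linked_refl.
  + by move=> [] [] _; apply: linked_refl.
  + by move=> [] [] _; apply: linked_refl.
  + by move=> [] []; apply: linked_refl.
  + by rewrite /= card_unit.
- by move=> [] [] _ _; constructor.
exists (@Valuation loop_net M (M * (int * int))%type (fun=> (0, (1,
  0))) (fun=> (0, (0, 1)))
   (fun=> (nu, (-1, -1))) (pair_inl M (int * int)%type)); split.
- by move=> []; rewrite /defect /=; congr (_, (_, _));
    rewrite /= ?subr0 ?add0r ?addr0.
- move=> H [vr vc vs vm] /(_ tt); rewrite /defect /= mulr0n add0r => E.
  pose f (x : M * (int * int)) : H := vm x.1 + (vr tt *~ x.2.1 + vc tt *~
    x.2.2).
  have fD : {morph f : x y / x + y}.
    by move=> [m [i j]] [m' [i' j']]; rewrite /f /= raddfD !mulrzDr; zmod.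
  exists (additive_of fD); split.
  + by move=> []; rewrite additive_ofE /f /= raddf0 mulr1z mulr0z addr0 add0r.
  + by move=> []; rewrite additive_ofE /f /= raddf0 mulr1z mulr0z !add0r.
  + by move=> []; rewrite additive_ofE /f /= -E !mulrN1z; zmod.
  + by move=> m; rewrite additive_ofE /f /= !mulr0z !addr0.
- move=> H g [/(_ tt)/= gr /(_ tt)/= gc _ gm] [m [i j]].
  have -> : (m, (i, j)) = pair_inl M (int * int)%type m + ((0, (1,
    0)) *~ i + (0, (0, 1)) *~ j) :> M * (int * int).
    rewrite !pair_mulrz /= !mul0rz !intz.
    by congr (_, (_, _)); rewrite /= ?addr0 ?add0r.
  by rewrite !raddfD gm !raddfMz gr gc !mul0rz !addr0.
Qed.

(** * The canonical group *)

Section PresentedGroup.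

Local Open Scope quotient_scope.

Variables (R C S : finType) (P : {set R * C * S}).
Local Notation free := {ffun R + C + S -> int}.

Definition class_of (x : free) : presented_group P := \pi_(presented_group P) x.

Lemma class_of_add : {morph class_of : x y / x + y}.
Proof. exact: Quotient.pi_add. Qed.

Lemma class_of_eqP x y : class_of x = class_of y <-> relations P (x - y).
Proof.
have E := Quotient.idealrBE (GRing.ZmodClosed.clone _ (relations P) _) x y.
by split=> [/eqP|rel]; [rewrite -E | apply/eqP; rewrite -E].
Qed.

Lemma class_of_surj (q : presented_group P) : class_of (generic_quotient.repr
  q) = q.
Proof. exact: reprK. Qed.

Definition class_map : {additive free -> presented_group P} :=
  additive_of class_of_add.

Lemma free_sum (x : free) : x = \sum_u generator u *~ x u.
Proof.
apply/ffunP=> v; rewrite sum_ffunE (bigD1 v) //= big1 => [|u uv].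
  by rewrite ffunMzE ffunE eqxx addr0 intz.
by rewrite ffunMzE ffunE eq_sym (negPf uv) mul0rz.
Qed.

Lemma class_of_relator t : t \in P -> class_of (relator t) = 0.
Proof.
move=> tP; rewrite -(raddf0 class_map); apply/class_of_eqP.
rewrite subr0; apply/asboolP; exists (fun u => (u == t)%:R).
rewrite (bigD1 t) //= eqxx mulr1z big1 ?addr0 // => u /andP[_ /negPf ->].
by rewrite mulr0z.
Qed.

Section Extend.

Variables (H : zmodType) (val : R + C + S -> H).

Definition extend (x : free) : H := \sum_u val u *~ x u.

Lemma extend_add : {morph extend : x y / x + y}.
Proof.
move=> x y; rewrite /extend -big_split; apply: eq_bigr => u _.
by rewrite ffunE mulrzDr.
Qed.

Definition extend_map : {additive free -> H} := additive_of extend_add.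

Lemma extend_generator u : extend (generator u) = val u.
Proof.
rewrite /extend (bigD1 u) //= ffunE eqxx mulr1z big1 ?addr0 // => v /negPf vu.
by rewrite ffunE vu mulr0z.
Qed.

Hypothesis val_relator : forall r c s, (r, c, s) \in P ->
  val (inl (inl r)) + val (inl (inr c)) + val (inr s) = 0.

Lemma extend_relations x : relations P x -> extend x = 0.
Proof.
move=> /asboolP[k ->]; rewrite -[extend _]/(extend_map _) raddf_sum big1 // =>
  -[[r c] s] tP.
rewrite raddfMz /extend_map additive_ofE /relator /= !(extend_add,
  extend_generator) val_relator //.
exact: mul0rz.
Qed.

Definition descend (q : presented_group P) : H := extend (generic_quotient.repr
  q).

Lemma descend_class x : descend (class_of x) = extend x.
Proof.
apply/eqP; rewrite -subr_eq0 -[_ - _](raddfB extend_map);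
  apply/eqP/extend_relations.
by apply/class_of_eqP; rewrite class_of_surj.
Qed.

Lemma descend_add : {morph descend : x y / x + y}.
Proof.
move=> x y; rewrite -(class_of_surj x) -(class_of_surj y) -class_of_add.
by rewrite !descend_class extend_add.
Qed.

Definition descend_map : {additive presented_group P -> H} := additive_of
  descend_add.

End Extend.

End PresentedGroup.

(** Both groups are universal for the same relations, which gives maps in both directions. *)
Lemma state_presented (D : net) (M G : zmodType) :
  (forall m : M, m = 0) -> @state D M (fun=> 0%N) (fun=> 0) G ->
  exists f : {additive presented_group (white D) -> G}, bijective f.
Proof.
move=> M0 [_ _ _ [v [vP vU vG]]]; pose A := presented_group (white D).
pose val u := match u with inl (inl r) => row_val v r | inl (inr c) =>
  col_val v c
  | inr s => sym_val v s end.
have val_rel r c s : (r, c, s) \in white D ->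
    val (inl (inl r)) + val (inl (inr c)) + val (inr s) = 0.
  case/imsetP=> a _ [-> -> ->]; have := vP a.
  by rewrite /defect mulr0n add0r raddf0.
have null_add : {morph (fun _ : M => 0 : A) : x y / x + y} by move=> x y;
  rewrite addr0.
pose gen u : A := class_of (white D) (generator u).
pose v' : valuation D M A := @Valuation D M A (fun r => gen (inl (inl r)))
  (fun c => gen (inl (inr c))) (fun s => gen (inr s)) (additive_of null_add).
have [g [gr gc gs _]] : exists g : {additive G -> A}, transports g v v'.
  apply: vU => a; rewrite mulr0n add0r raddf0 /defect /= /gen -!class_of_add.
  by apply: (@class_of_relator _ _ _ _ (left_of a, right_of a, tail a));
    apply: imset_f.
have gval u : g (val u) = gen u by case: u => [[r|c]|s];
  [exact: gr|exact: gc|exact: gs].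
exists (descend_map val_rel); exists g => [q|x].
  rewrite -(class_of_surj q) additive_ofE descend_class //.
  rewrite [in RHS](free_sum (generic_quotient.repr q)) -[RHS]/(class_map _ _)
    !raddf_sum.
  by apply: eq_bigr => u _; rewrite !raddfMz gval.
(* The composite on [G] minus the identity kills the universal solution, hence vanishes. *)
have h_add : {morph (fun x => descend_map val_rel (g x) - x) : x y / x + y}.
  by move=> x' y'; rewrite (raddfD g) (raddfD (descend_map val_rel)); zmod.
apply/eqP; rewrite -subr_eq0; apply/eqP; apply: (vG _ (additive_of h_add)).
have fgen u : descend_map val_rel (g (val u)) - val u = 0.
  by rewrite gval additive_ofE descend_class // extend_generator subrr.
split=> [r|c|s|m]; [exact: fgen (inl (inl r))|exact: fgen (inl (inr c))|exact:
  fgen (inr s)|].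
by rewrite [m]M0 !raddf0.
Qed.

(** * Isomorphisms of products and direct sums *)

Lemma zmod_isoP (A B : zmodType) (f : A -> B) (g : B -> A) :
  {morph f : x y / x + y} -> cancel f g -> cancel g f -> zmod_isomorphic A B.
Proof. by move=> fD fK gK; exists (additive_of fD); exists g. Qed.

Lemma iso_refl A : zmod_isomorphic A A.
Proof. by apply: (zmod_isoP (f := id) (g := id)). Qed.

Lemma iso_sym A B : zmod_isomorphic A B -> zmod_isomorphic B A.
Proof.
case=> f [g fK gK]; apply: (zmod_isoP (f := g) (g := f)) => // x y.
by rewrite -[RHS]fK raddfD !gK.
Qed.

Lemma iso_trans A B C :
  zmod_isomorphic A B -> zmod_isomorphic B C -> zmod_isomorphic A C.
Proof.
case=> f [f' fK f'K] [g [g' gK g'K]].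
apply: (zmod_isoP (f := g \o f) (g := f' \o g')) => [x y||]; last 2 first.
- exact: can_comp.
- exact: can_comp.
by rewrite /= !raddfD.
Qed.

Lemma iso_prod (A B C D : zmodType) : zmod_isomorphic A B ->
  zmod_isomorphic C D -> zmod_isomorphic (A * C)%type (B * D)%type.
Proof.
case=> f [f' fK f'K] [g [g' gK g'K]].
apply: (zmod_isoP (f := fun x => (f x.1, g x.2)) (g := fun y =>
  (f' y.1, g' y.2))).
- by move=> x y; rewrite /= !raddfD.
- by move=> [x y]; rewrite /= fK gK.
- by move=> [x y]; rewrite /= f'K g'K.
Qed.

Lemma iso_prodC (A B : zmodType) : zmod_isomorphic (A * B)%type (B * A)%type.
Proof.
by apply: (zmod_isoP (f := fun x => (x.2, x.1)) (g := fun x => (x.2, x.1))) =>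
  [x y|[]|[]].
Qed.

Lemma iso_prodA (A B C : zmodType) :
  zmod_isomorphic (A * (B * C))%type (A * B * C)%type.
Proof.
by apply: (zmod_isoP (f := fun x => (x.1, x.2.1, x.2.2))
  (g := fun x => (x.1.1, (x.1.2, x.2)))) => [x y|[? []]|[[]]].
Qed.

Lemma iso_trivial (A B : zmodType) : (forall x : A, x = 0) -> (forall y : B,
  y = 0) ->
  zmod_isomorphic A B.
Proof.
move=> A0 B0; apply: (zmod_isoP (f := fun _ : A => 0 : B) (g := fun _ : B =>
  0 : A)) => [x y|x|y].
- by rewrite addr0.
- by rewrite (A0 x).
- by rewrite (B0 y).
Qed.

Lemma iso_prod0 (A B : zmodType) : (forall x : A, x = 0) ->
  zmod_isomorphic (A * B)%type B.
Proof.
move=> A0; apply: (zmod_isoP (f := snd) (g := fun y => (0, y))) =>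
  [x y|[x y]|y] //=.
by rewrite (A0 x).
Qed.

Lemma iso_ffun_recl n (A : zmodType) :
  zmod_isomorphic (A * {ffun 'I_n -> A})%type {ffun 'I_n.+1 -> A}.
Proof.
apply: (zmod_isoP (f := fun x : A * {ffun 'I_n -> A} =>
    [ffun i => oapp x.2 x.1 (unlift ord0 i)] : {ffun 'I_n.+1 -> A})
  (g := fun y : {ffun 'I_n.+1 -> A} => (y ord0, [ffun i => y (lift ord0 i)]))).
- by move=> [x u] [y v]; apply/ffunP => i; rewrite !ffunE;
    case: (unlift _ _) => //= j; rewrite ffunE.
- move=> [x u]; congr pair; first by rewrite ffunE unlift_none.
  by apply/ffunP => i; rewrite !ffunE liftK.
- move=> y; apply/ffunP => i; rewrite ffunE.
  by case: unliftP => [j|] -> //=; rewrite ffunE.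
Qed.

Lemma iso_ffun_add m n (A : zmodType) :
  zmod_isomorphic ({ffun 'I_m -> A} * {ffun 'I_n -> A})%type {ffun 'I_(m + n)
    -> A}.
Proof.
elim: m => [|m IH].
  by apply: iso_prod0 => x; apply/ffunP => -[].
apply: iso_trans (iso_prod (iso_sym (iso_ffun_recl _ _)) (iso_refl _)) _.
apply: iso_trans (iso_sym (iso_prodA _ _ _)) _.
exact: iso_trans (iso_prod (iso_refl _) IH) (iso_ffun_recl _ _).
Qed.

Section OrdCons.

Variables (n : nat) (A : 'I_n.+1 -> Type) (x : A ord0)
  (u : forall j, A (lift ord0 j)).

(** A dependent cons, kept transparent so that the equations below can compute; the transport along
    a proof of equality of indices disappears by [eq_irrelevance]. *)
Definition ord_cons i : A i.
Proof. by case: (unliftP ord0 i) => [j|] ->; [exact: u | exact: x]. Defined.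

Lemma ord_cons0 : ord_cons ord0 = x.
Proof.
rewrite /ord_cons; case: unliftP => [j e|e].
  by case/eqP: (neq_lift ord0 j).
by rewrite (eq_irrelevance e erefl).
Qed.

Lemma ord_cons_lift j : ord_cons (lift ord0 j) = u j.
Proof.
rewrite /ord_cons; case: unliftP => [k e|e].
  have kj := lift_inj e; rewrite -{}kj in e *.
  by rewrite (eq_irrelevance e erefl).
by case/eqP: (neq_lift ord0 j).
Qed.

End OrdCons.

Lemma iso_direct_sum_recl n (A : 'I_n.+1 -> zmodType) :
  zmod_isomorphic (A ord0 * direct_sum (fun i =>
    A (lift ord0 i)))%type (direct_sum A).
Proof.
apply: iso_sym.
apply: (zmod_isoP (f := fun y : direct_sum A => (y ord0, [ffun i =>
  y (lift ord0 i)] : direct_sum _))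
  (g := fun x => [ffun i => ord_cons (A := A) x.1 x.2 i] : direct_sum A)).
- move=> x y; congr pair; first by rewrite ffunE.
  by apply/ffunP => i; rewrite !ffunE.
- move=> y; apply/ffunP => i; rewrite ffunE.
  case: (unliftP ord0 i) => [j|] ->; first by rewrite ord_cons_lift ffunE.
  by rewrite ord_cons0.
- move=> [x u]; congr pair; first by rewrite ffunE ord_cons0.
  by apply/ffunP => i; rewrite !ffunE ord_cons_lift.
Qed.

(** * Assembling the target group *)

Lemma realizable_stack p (M : zmodType) (nu : M) :
  (1 < p)%N -> realizable nu 0 -> nu *+ p = 0 ->
  forall k j, (j <= k.*2)%N -> exists (N : zmodType) (mu : N),
    [/\ realizable mu k, mu *+ p = 0 &
        zmod_isomorphic N ({ffun 'I_j -> 'Z_p} * M)%type].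
Proof.
move=> p_gt1 nuR nu_p; elim=> [|k IH] j.
  rewrite leqn0 => /eqP ->; exists M, nu; split=> //.
  by apply/iso_sym/iso_prod0 => x; apply/ffunP => -[].
have Zp1 : 1 *+ p = 0 :> 'Z_p by rewrite pchar_Zp.
(* Each unit of weight offers two new arcs, so up to two twists are placed at this level and the
   others in the levels below. *)
case: j => [|[|j]] jk.
- have [N [mu [muR mu_p NE]]] := IH 0%N isT; exists N, mu; split=> //.
  exact: realizable_triple0.
- have [N [mu [muR mu_p NE]]] := IH 0%N isT.
  exists (N * 'Z_p)%type, (mu, 1); split; first exact: realizable_triple1.
    by rewrite pair_mulrn /= mu_p Zp1.
  apply: iso_trans (iso_prodC _ _) _.
  apply: iso_trans (iso_prod (iso_refl _) NE) _.
  exact: iso_trans (iso_prodA _ _ _) (iso_prod (iso_ffun_recl _ _) (iso_refl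
    _)).
- have [N [mu [muR mu_p NE]]] := IH j jk.
  exists (N * 'Z_p * 'Z_p)%type, ((mu, 1), -1); split;
    first exact: realizable_triple2.
    by rewrite !pair_mulrn /= mu_p mulNrn Zp1 oppr0.
  apply: iso_trans (iso_prodC _ _) _.
  apply: iso_trans (iso_prod (iso_refl _) (iso_prodC _ _)) _.
  apply: iso_trans (iso_prod (iso_refl _) (iso_prod (iso_refl _) NE)) _.
  apply: iso_trans (iso_prod (iso_refl _) (iso_trans (iso_prodA _ _ _)
    (iso_prod (iso_ffun_recl _ _) (iso_refl _)))) _.
  exact: iso_trans (iso_prodA _ _ _) (iso_prod (iso_ffun_recl _ _) (iso_refl
    _)).
Qed.

Definition target_group p k (a : 'I_k -> nat) n : zmodType :=
  ({ffun 'I_n -> 'Z_p} * direct_sum (fun i : 'I_k => 'Z_(p * a i)))%type.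

(** Induction on the list of the a_i, building from the innermost bundle outwards. That [p] kills
    [nu] is carried along because the next nested move requires it. Loops are handled only for k >
    0, where the outermost move is a nested one. *)
Lemma realizable_target p k (a : 'I_k -> nat) n :
  (1 < p)%N -> (forall i,
    2 <= a i)%N -> (n <= 1 + 2 * \sum_(i < k) (a i - 1))%N ->
  exists (M : zmodType) (nu : M), [/\ (0 < k)%N -> loop_realizable nu,
    realizable nu 0, nu *+ p = 0 & zmod_isomorphic M (target_group p a n)].
Proof.
move=> p_gt1; elim: k a n => [|k IH] a n a_ge2.
  have ds0 (x : direct_sum (fun i : 'I_0 =>
    'Z_(p * a i))) : x = 0 by apply/ffunP => -[].
  have I0 (x : 'I_1) : x = 0 by rewrite ord1.
  have f0 (x : {ffun 'I_0 -> 'Z_p}) : x = 0 by apply/ffunP => -[].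
  (* No a_i is left and n is 0 or 1; ['I_1] serves as the trivial group. *)
  rewrite big_ord0; case: n => [|[|//]] _.
    exists 'I_1, 0; split=> //; try exact: mul0rn;
      first exact: realizable_trivial.
    by apply: iso_trivial => // -[x y]; rewrite (ds0 y) (f0 x).
  exists ('I_1 * 'Z_p)%type, (0, 1); split=> //; first exact: realizable_twist.
    by rewrite pair_mulrn mul0rn pchar_Zp.
  apply: iso_trans (iso_prod0 _ I0) _; apply: iso_sym.
  apply: iso_trans (iso_prodC _ _) _; apply: iso_trans (iso_prod0 _ ds0) _.
  apply: iso_trans (iso_sym (iso_ffun_recl _ _)) _.
  by apply: iso_trans (iso_prodC _ _) _; apply: iso_prod0.
rewrite big_ord_recl => n_le; set b := fun i => a (lift ord0 i).
have [q a0E] : exists q, a ord0 = q.+1 by exists (a ord0).-1;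
  rewrite prednK // ltnW.
(* The bundle for the first a_i has weight q = a_i - 1 and room for 2 q twists; it takes as many as
   possible and the rest go to the later bundles. *)
pose n0 := minn n (q.*2); pose n1 := (n - n0)%N.
have nE : n = (n0 + n1)%N by rewrite /n1 subnKC // geq_minl.
have n1_le : (n1 <= 1 + 2 * \sum_(i < k) (b i - 1))%N.
  by move: n_le; rewrite a0E /n1 /n0 /b; set s := (\sum_(_ < _) _)%N; lia.
have [M [nu [_ nuR nu_p ME]]] := IH b n1 (fun i => a_ge2 _) n1_le.
have [N [mu [muR mu_p NE]]] := realizable_stack p_gt1 nuR nu_p (geq_minr n
  q.*2).
have q_gt0 : (1 <= q)%N by have := a_ge2 ord0; rewrite a0E.
have R := realizable_nested p_gt1 muR q_gt0 mu_p.
exists (N * 'Z_(p * q.+1))%type, (- mu, q.+1%:R); split=> //.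
- exact: loop_realizable_realizable.
- rewrite pair_mulrn /= mulNrn mu_p oppr0 -mulrnA mulnC pchar_Zp //.
  exact: leq_trans p_gt1 (leq_pmull _ _).
have targetE : target_group p a n = target_group p a (n0 + n1) by rewrite -nE.
rewrite -a0E targetE /target_group.
apply: iso_trans (iso_prod NE (iso_refl _)) _.
apply: iso_trans (iso_prod (iso_prod (iso_refl _) ME) (iso_refl _)) _.
apply: iso_trans (iso_prod (iso_prodA _ _ _) (iso_refl _)) _.
apply: iso_trans (iso_prod (iso_prod (iso_ffun_add _ _ _) (iso_refl _))
  (iso_refl _)) _.
apply: iso_trans (iso_sym (iso_prodA _ _ _)) _.
apply: iso_prod; first exact: iso_refl.
apply: iso_trans (iso_prodC _ _) _.
exact: (iso_direct_sum_recl (fun i => 'Z_(p * a i))).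
Qed.

(** The integer coordinates of a torsion element vanish, since [int] is torsion free. *)
Lemma torsion_iso (A M : zmodType) :
  zmod_isomorphic A (M * (int * int))%type ->
  (forall m : M, exists2 k, (0 < k)%N & m *+ k = 0) ->
  zmod_isomorphic (torsion_subgroup A) M.
Proof.
case=> f [g fK gK] M_tors.
have g_tors m : torsion (g (m, 0)).
  have [k k0 mk] := M_tors m; apply/asboolP; exists k => //.
  apply: (can_inj fK); rewrite raddfMn gK raddf0 pair_mulrn mk.
  by rewrite mul0rn.
have f2 (x : torsion_subgroup A) : (f (val x)).2 = 0.
  have /asboolP[k k0 xk] := valP x.
  have : f (val x) *+ k = 0 by rewrite -raddfMn xk raddf0.
  case: (f (val x)) => m [i j]; rewrite !pair_mulrn => -[_] /= /eqP.
  rewrite Num.Theory.mulrn_eq0 => ik /eqP; rewrite Num.Theory.mulrn_eq0 => jk.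
  by move: ik jk; rewrite (gtn_eqF k0) /= => /eqP -> /eqP ->.
apply: (zmod_isoP (f := fun x : torsion_subgroup A => (f (val x)).1)
  (g := fun m => Sub (g (m, 0)) (g_tors m) : torsion_subgroup A)).
- by move=> x y; rewrite raddfD raddfD.
- move=> x; apply: val_inj; rewrite SubK -[RHS]fK; congr g.
  by rewrite [RHS]surjective_pairing f2.
- by move=> m; rewrite SubK gK.
Qed.

Lemma Zp_mulrn m r (x : 'Z_m) : (1 < m)%N -> (m %| r)%N -> x *+ r = 0.
Proof.
move=> m_gt1 /dvdnP[q ->]; rewrite mulnC mulrnA.
by rewrite -[x *+ m]mulr_natr pchar_Zp // mulr0 mul0rn.
Qed.

Lemma direct_sum_mulrn (I : finType) (A : I -> zmodType) (v : direct_sum A) r i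
  :
  (v *+ r) i = v i *+ r.
Proof.
elim: r => [|r IH]; first by rewrite !mulr0n ffunE.
by rewrite !mulrS ffunE IH.
Qed.

Lemma target_torsion p k (a : 'I_k -> nat) n (m : target_group p a n) :
  (1 < p)%N -> (forall i, 2 <= a i)%N -> exists2 r, (0 < r)%N & m *+ r = 0.
Proof.
move=> p_gt1 a_ge2.
(* A common multiple of the orders of all the cyclic factors; the leading [p] takes care of the
   ['Z_p] summands. *)
exists (p * \prod_(i < k) (p * a i))%N.
  rewrite muln_gt0 (ltnW p_gt1) /=; apply: prodn_gt0 => i.
  by rewrite muln_gt0 (ltnW p_gt1) (ltn_trans _ (a_ge2 i)).
case: m => u v; rewrite pair_mulrn /=; congr pair; apply/ffunP => i.
  by rewrite ffunMnE ffunE Zp_mulrn // dvdn_mulr.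
rewrite direct_sum_mulrn ffunE Zp_mulrn //.
  exact: leq_trans p_gt1 (leq_pmulr _ (ltnW (a_ge2 i))).
by rewrite (bigD1 i) //= dvdn_mull // dvdn_mulr.
Qed.

Local Close Scope ring_scope.

Theorem theorem2p6 (p k : nat) (a : 'I_k -> nat) (n : nat)
    (p_prime : prime p) (k_ge1 : 1 <= k) (a_ge2 : forall i, 2 <= a i)
    (n_le : n <= 1 + 2 * \sum_(i < k) (a i - 1)) :
  exists (R C S : finType) (W B : {set R * C * S}),
    spherical_bitrade W B /\
    zmod_isomorphic (canonical_group W)
      ({ffun 'I_n -> 'Z_p} * direct_sum (fun i : 'I_k => 'Z_(p * a i)))%type.
Proof.
have p_gt1 := prime_gt1 p_prime.
have [M [nu [/(_ k_ge1)/loop_realized R _ _ ME]]] := realizable_target p_gt1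
  a_ge2 n_le.
have [D [T [T0 st]]] := R; have [f f_bij] := state_presented T0 st.
have [D0 sc ll _] := st.
exists (rows D), (cols D), (syms D), (white D), (black D); split.
  (* All weights are zero here, so [simple_off] amounts to simplicity. *)
  by apply: net_spherical => // b c l r; case: (sc b c l r).
apply: (torsion_iso (M := target_group p a n)); last by move=> m;
  apply: target_torsion.
apply: iso_trans (iso_prod ME (iso_refl _)).
by exists f.
Qed.
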